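(* Let $\mathbb{F}_q$ be the finite field with $q$ elements. For every integer $m\ge1$ and all integers $n,p,d\ge0$, $$\bigl|C_{p,d}(\mathbb{P}^n)(\mathbb{F}_{q^m})\bigr|\equiv\binom{v_{p,n}+d-1}{d}\pmod{q-1},\qquad v_{p,n}=\binom{n+1}{p+1}.$$
   Context: $C_{p,d}(\mathbb{P}^n)$ is the Chow variety over $\mathbb{F}_q$: the reduced projective scheme over $\mathbb{F}_q$, given by Chow forms, whose $\overline{\mathbb{F}}_q$-points correspond to effective algebraic $p$-cycles of degree $d$ in $\mathbb{P}^n_{\overline{\mathbb{F}}_q}$; $C_{p,0}(\mathbb{P}^n)$ is a single rational point. $X(\mathbb{F}_{q^m})$ is the set of $\mathbb{F}_{q^m}$-rational points. Binomial coefficients use $\binom{a}{0}=1$ for all integers $a$, and $\binom{d-1}{d}=0$ for $d\ge1$. *)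

(* Defs.v *)
From HB Require Import structures.
From mathcomp Require Import all_boot all_order all_algebra all_field.
From mathcomp Require Import boolp classical_sets functions cardinality.
From mathcomp Require Import mpoly.

Set Implicit Arguments.
Unset Strict Implicit.
Unset Printing Implicit Defensive.

Import GRing.Theory.
Local Open Scope classical_set_scope.
Local Open Scope card_scope.
Local Open Scope ring_scope.

(* P(V): a point is a line through the origin of V. *)
Record proj (k : fieldType) (V : vectType k) := Proj {
  line :> {vspace V};
  dim_line : \dim line = 1%N
}.

Definition pspace (k : fieldType) (n : nat) : Type := proj 'rV[k]_n.+1.

Section Varieties.
Variables (K : closedFieldType) (n : nat).

Definition zero_locus (E : set {mpoly K[n.+1]}) : set (pspace K n) :=
  [set P : pspace K n | forall f x, E f -> x \in line P -> f.@[x 0] = 0].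

Definition zariski_closed (Z : set (pspace K n)) : Prop :=
  exists2 E : set {mpoly K[n.+1]},
    (forall f, E f -> exists e : nat, f \is e.-homog) & Z = zero_locus E.

Definition subvariety (Z : set (pspace K n)) : Prop :=
  [/\ zariski_closed Z, Z !=set0 &
      forall A B, zariski_closed A -> zariski_closed B ->
        Z `<=` A `|` B -> Z `<=` A \/ Z `<=` B].

Definition has_chain (Z : set (pspace K n)) (r : nat) : Prop :=
  exists c : nat -> set (pspace K n),
    [/\ forall i, (i <= r)%N -> subvariety (c i),
        forall i, (i < r)%N -> c i `<` c i.+1 & c r `<=` Z].

(* Krull dimension *)
Definition has_dim (Z : set (pspace K n)) (p : nat) : Prop :=
  has_chain Z p /\ ~ has_chain Z p.+1.

(* The linear subspace of P^n cut out by the r hyperplanes whose equations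
   are the rows of u. *)
Definition linear_section (r : nat) (u : 'M[K]_(r, n.+1)) :
    set (pspace K n) :=
  [set P : pspace K n | forall x, x \in line P -> u *m x^T = 0].

(* A p-dimensional Z has degree e when p general hyperplanes meet Z in exactly
   e points; "general" means outside the zeros of a nonzero polynomial G in the
   coefficients of the p linear forms. *)
Definition has_degree (p : nat) (Z : set (pspace K n)) (e : nat) : Prop :=
  exists2 G : {mpoly K[p * n.+1]}, G != 0 &
    forall u : 'M[K]_(p, n.+1), G.@[mxvec u 0] != 0 ->
      (Z `&` linear_section u) #= `I_e.

End Varieties.

(* An effective p-cycle \sum_i mult_i Z_i. The Z_i need not be distinct: two
   presentations of the same cycle have the same degree and Chow form. *)
Record effective_cycle (K : closedFieldType) (n p : nat) := EffectiveCycle {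
  cycle_size : nat;
  component : 'I_cycle_size -> set (pspace K n);
  multiplicity : 'I_cycle_size -> nat;
  component_subvariety : forall i, subvariety (component i);
  component_dim : forall i, has_dim (component i) p
}.

Definition cycle_has_degree (K : closedFieldType) (n p : nat)
    (C : effective_cycle K n p) (d : nat) : Prop :=
  exists2 e : 'I_(cycle_size C) -> nat,
    (forall i, has_degree p (component i) (e i)) &
    (\sum_i multiplicity i * e i)%N = d.

Definition irreducible_mpoly (k : fieldType) (N : nat) (f : {mpoly k[N]}) :
    Prop :=
  f \isn't a GRing.unit /\
  forall g h : {mpoly k[N]}, f = g * h ->
    g \is a GRing.unit \/ h \is a GRing.unit.

(* The Chow form of an irreducible p-dimensional Z, unique up to a nonzero
   scalar: the irreducible polynomial in the coefficients of p + 1 linear forms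
   that vanishes exactly when these forms have a common zero on Z. *)
Definition chow_form (K : closedFieldType) (n p : nat) (Z : set (pspace K n))
    (f : {mpoly K[p.+1 * n.+1]}) : Prop :=
  irreducible_mpoly f /\
  forall u : 'M[K]_(p.+1, n.+1),
    f.@[mxvec u 0] = 0 <-> Z `&` linear_section u !=set0.

Definition cycle_chow_form (K : closedFieldType) (n p : nat)
    (C : effective_cycle K n p) (f : {mpoly K[p.+1 * n.+1]}) : Prop :=
  exists2 g : 'I_(cycle_size C) -> {mpoly K[p.+1 * n.+1]},
    (forall i, chow_form (component i) (g i)) &
    f = \prod_i g i ^+ multiplicity i.

(* The projective space in which the Chow forms of cycles of degree d live:
   such a form has degree d in each of the p + 1 rows of variables, hence total
   degree (p + 1) d. *)
Definition form_space (k : fieldType) (n p d : nat) : Type :=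
  proj (dhomog (p.+1 * n.+1) k (p.+1 * d)).

(* The geometric points of C_{p,d}(P^n). *)
Definition chow_variety (K : closedFieldType) (n p d : nat) :
    set (form_space K n p d) :=
  [set Q | exists C : effective_cycle K n p,
      cycle_has_degree C d /\
      exists2 f, f \in line Q & cycle_chow_form C (mpoly_of_dhomog f)].

(* The L-rational points of X: the points of the ambient projective space over
   L whose extension of scalars to K lies in X. *)
Definition rational_points (L : fieldType) (K : closedFieldType)
    (iota : {rmorphism L -> K}) (n p d : nat) (X : set (form_space K n p d)) :
    set (form_space L n p d) :=
  [set P | exists2 Q, X Q &
      forall f, f \in line P -> exists2 g, g \in line Q &
        map_mpoly iota (mpoly_of_dhomog f) = mpoly_of_dhomog g].

(* Main.v *)
From HB Require Import structures.
Require Import Defs.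
From mathcomp Require Import all_boot all_order all_fingroup all_algebra.
From mathcomp Require Import all_solvable all_field.
From mathcomp Require Import boolp classical_sets functions cardinality.
From mathcomp Require Import mpoly.

(* The torus of diagonal matrices acts on cycles, and on Chow forms by scaling
   the columns of the matrix of coefficients.  A Chow form over F_(q^m) that is not
   homogeneous in the variables of some column j lies on an orbit of the j-th
   one-parameter subgroup which, once the weights are divided by their gcd, is a
   free orbit of F_(q^m)^*; so modulo q - 1 only the forms homogeneous in every
   column count.  Their irreducible factors are then column-homogeneous too, and a
   column-homogeneous Chow form of an irreducible p-dimensional Z is, up to a
   scalar, a maximal minor of the generic matrix: a point of Z with more than p + 1
   nonzero coordinates would, moved by the torus, lie on a general linear section
   of codimension p + 1, so Z is contained in a coordinate p-plane, and a form that
   vanishes only where a minor does is a power of that minor.  Hence the remaining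
   forms are the products of d maximal minors, one for each multiset of size d of
   coordinate p-planes. *)

Set Implicit Arguments.
Unset Strict Implicit.
Unset Printing Implicit Defensive.

Import GRing.Theory.
Local Open Scope classical_set_scope.
Local Open Scope card_scope.
Local Open Scope ring_scope.

(** * Polynomials over an algebraically closed field *)

(** Chow forms are used through their definition alone, and neither the Nullstellensatz nor unique
    factorization is invoked. In their place, a polynomial that is nonzero wherever a minor is
    nonzero is shown directly to be a scalar multiple of a power of that minor, and the exponents in
    two products of minors are compared at a matrix where just one minor vanishes. Since dimension
    means length of chains of subvarieties, the bound on chains in a coordinate plane is obtained by
    counting independent polynomials of bounded degree. Dividing the weights by their gcd k is
    legitimate because s in [L] has a k-th root t in [K]. Scaling a column by t moves cycles over
    [K], and up to a power of t it multiplies the coefficients by powers of s, so they stay in [L].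
    A rational point is represented by the form whose pivot coefficient is 1; a pivot of minimal
    weight is fixed by the action. The congruence is first obtained modulo q^m - 1, a multiple of q
    - 1. The size d of the multisets is read off from the total degree (p + 1) d, each maximal minor
    having degree p + 1. *)

Lemma horner_nonroot (K : closedFieldType) (p : {poly K}) :
  p != 0 -> exists x, p.[x] != 0.
Proof. by move=> /closed_nonrootP[x]; exists x. Qed.

Lemma nowhere_zero_poly_const (K : closedFieldType) (p : {poly K}) :
  (forall x, p.[x] != 0) -> forall x y, p.[x] = p.[y].
Proof.
move=> p_neq0 x y; have [/size1_polyC->|] := leqP (size p) 1%N.
  by rewrite !hornerC.
move=> sp; have /closed_rootP[z] : size p != 1%N by rewrite gtn_eqF.
by rewrite rootE (negPf (p_neq0 z)).
Qed.

Lemma horner_mmap (R S : comNzRingType) n (c : {rmorphism R -> {poly S}})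
    (h : {rmorphism R -> S}) (f : {mpoly R[n]}) (v : 'I_n -> {poly S}) x :
  (forall a, (c a).[x] = h a) ->
  (mmap c v f).[x] = mmap h (fun i => (v i).[x]) f.
Proof.
move=> cx; rewrite /mmap horner_sum; apply: eq_bigr => m _.
rewrite hornerM cx /mmap1 horner_prod.
by under eq_bigr do rewrite horner_exp.
Qed.

Lemma horner_mpath (R : comNzRingType) n (f : {mpoly R[n]})
    (v : 'I_n -> {poly R}) x :
  (mmap polyC v f).[x] = f.@[fun i => (v i).[x]].
Proof. by rewrite (@horner_mmap _ _ _ _ idfun) // => a; rewrite hornerC. Qed.

Lemma mmap_eq n (R S : nzRingType) (h : R -> S) (v w : 'I_n -> S) p :
  v =1 w -> mmap h v p = mmap h w p.
Proof.
by move=> vw; apply: eq_bigr => m _; rewrite (mmap1_eq _ vw).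
Qed.

Lemma mmap_comp n (R S T : comNzRingType) (h : {rmorphism R -> S})
    (g : {rmorphism S -> T}) (v : 'I_n -> S) p :
  g (mmap h v p) = mmap (g \o h) (g \o v) p.
Proof.
rewrite /mmap rmorph_sum; apply: eq_bigr => m _.
rewrite rmorphM /mmap1 rmorph_prod.
by under eq_bigr do rewrite rmorphXn.
Qed.

Lemma mpoly_mmap_id n (R : comNzRingType) (p : {mpoly R[n]}) :
  mmap (@mpolyC n R) (fun i => 'X_i) p = p.
Proof.
rewrite [RHS]mpolyE; apply: eq_bigr => m _.
by rewrite mmap1_id mul_mpolyC.
Qed.

Section SubstVar.
Variables (K : closedFieldType) (N : nat).

Let free_in (i : 'I_N) : 'I_N -> {poly {mpoly K[N]}} :=
  fun j => if j == i then 'X else ('X_j)%:P.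

Let expand (i : 'I_N) (f : {mpoly K[N]}) := mmap (polyC \o @mpolyC N K) (free_in i) f.

(** View [f] as a polynomial in ['X_i] and choose a monomial occurring in one of its coefficients.
    Reading off that monomial in every coefficient gives a nonzero element of [{poly K}], and any
    nonroot of it serves as [c]. *)
Lemma subst_var_neq0 (i : 'I_N) (f : {mpoly K[N]}) : f != 0 ->
  exists c, mmap (@mpolyC N K) (fun j => if j == i then c%:MP else 'X_j) f != 0.
Proof.
move=> f0; have horn c : (expand i f).[c] =
    mmap (@mpolyC N K) (fun j => if j == i then c else 'X_j) f.
  rewrite /expand (@horner_mmap _ _ _ _ (@mpolyC N K)); last first.
    by move=> a; rewrite hornerC.
  by apply: mmap_eq => j; rewrite /free_in; case: ifP; rewrite ?hornerX ?hornerC.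
have q0 : expand i f != 0.
  apply: contraNneq f0 => e; move: (horn 'X_i); rewrite e horner0.
  move=> e0; apply/eqP; rewrite [RHS]e0 -[LHS]mpoly_mmap_id.
  by apply: mmap_eq => j; case: eqP => // ->.
have {q0} [k qk] : exists k, (expand i f)`_k != 0.
  by exists (size (expand i f)).-1; rewrite -lead_coefE lead_coef_eq0.
have [m qkm] : exists m, ((expand i f)`_k)@_m != 0.
  by exists (mlead (expand i f)`_k); rewrite mleadc_eq0.
have p0 : map_poly (mcoeff m) (expand i f) != 0.
  by apply: contraNneq qkm => e; rewrite -coef_map e coef0.
have [c pc] := horner_nonroot p0; exists c.
apply: contraNneq pc; rewrite -horn => e.
have : ((expand i f).[c%:MP])@_m = 0 by rewrite e mcoeff0.
rewrite horner_coef raddf_sum /= => e0; apply/eqP; rewrite -[RHS]e0.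
rewrite (horner_coef_wide _ (size_poly _ _)); apply: eq_bigr => j _.
by rewrite coef_map /= -rmorphXn [in RHS]mulrC mcoeffCM mulrC.
Qed.

Lemma mpoly_nonroot (f : {mpoly K[N]}) :
  f != 0 -> exists v, f.@[v] != 0.
Proof.
(* [sub s v] freezes the variables listed in [s] at the values [v]; they are frozen one after
   another until only a constant is left. *)
move=> f0; pose sub (s : seq 'I_N) (v : 'I_N -> K) (j : 'I_N) : {mpoly K[N]} :=
  if j \in s then (v j)%:MP else 'X_j.
suff [v] : exists v, mmap (@mpolyC N K) (sub (enum 'I_N) v) f != 0.
  have -> : mmap (@mpolyC N K) (sub (enum 'I_N) v) f = (f.@[v])%:MP.
    rewrite /meval (@mmap_comp _ _ _ _ idfun (@mpolyC N K)).
    by apply: mmap_eq => j; rewrite /sub mem_enum.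
  by rewrite mpolyC_eq0; exists v.
elim: (enum _) => [|i s [v IH]].
  exists (fun=> 0); rewrite (_ : mmap _ _ _ = f) //.
  by rewrite -[RHS]mpoly_mmap_id; apply: mmap_eq => j.
have [c] := subst_var_neq0 i IH.
rewrite (@mmap_comp _ _ _ _ _ (mmap (@mpolyC N K) _)) => H.
exists (fun j => if j \in s then v j else c).
apply: contraNneq H => /eqP; rewrite /mmap /sub => /eqP H.
apply/eqP; rewrite -[RHS]H; apply: eq_bigr => m _.
rewrite /= mmapC; congr (_ * _); apply: mmap1_eq => j /=.
rewrite inE; case: (boolP (j \in s)) => js; first by rewrite orbT mmapC.
by rewrite orbF mmapX mmap1U; case: eqP.
Qed.

End SubstVar.

Lemma mpoly_eq0_eval (K : closedFieldType) N (f : {mpoly K[N]}) :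
  (forall v, f.@[v] = 0) -> f = 0.
Proof.
move=> H; apply/eqP; apply: contraT => /mpoly_nonroot[v].
by rewrite H eqxx.
Qed.

Lemma irreducible_mpoly_neq0 (k : fieldType) N (f : {mpoly k[N]}) :
  irreducible_mpoly f -> f != 0.
Proof.
move=> [fN fI]; apply: contraNneq fN => f0.
by have [] := fI 0 f; rewrite ?mul0r // f0.
Qed.

Lemma rV_neq0_coord (F : fieldType) n (x : 'rV[F]_n) : x != 0 -> exists j, x 0 j != 0.
Proof.
move=> x0; apply/existsP; apply: contraNT x0; rewrite negb_exists => /forallP H.
by apply/eqP/rowP => j; rewrite mxE; have := H j; rewrite negbK => /eqP.
Qed.

(** * Minors of the generic matrix *)

Lemma mxvec_index_eq a b (i k : 'I_a) (j l : 'I_b) :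
  (mxvec_index i j == mxvec_index k l) = (i == k) && (j == l).
Proof.
rewrite /mxvec_index (inj_eq (@cast_ord_inj _ _ _)) (inj_eq enum_rank_inj).
by rewrite xpair_eqE.
Qed.

Section GenericMatrix.
Variables (K : closedFieldType) (a b : nat).
Local Notation PR := {mpoly K[a * b]}.
Implicit Types (u : 'M[K]_(a, b)) (f g : PR).

Definition generic_mx (R : nzRingType) : 'M[{mpoly R[a * b]}]_(a, b) :=
  \matrix_(i, j) 'X_(mxvec_index i j).

Definition mxeval f u : K := f.@[mxvec u 0].

Lemma generic_mx_eval u : map_mx (meval (mxvec u 0)) (generic_mx K) = u.
Proof. by apply/matrixP => i j; rewrite !mxE mevalXU mxvecE. Qed.

Lemma mxeval_vec f (v : 'I_(a * b) -> K) :
  f.@[v] = mxeval f (vec_mx (\row_i v i)).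
Proof. by apply: meval_eq => i; rewrite vec_mxK mxE. Qed.

Lemma mxeval_nonroot f : f != 0 -> exists u, mxeval f u != 0.
Proof.
by move=> /mpoly_nonroot[v]; rewrite mxeval_vec; exists (vec_mx (\row_i v i)).
Qed.

Lemma mxeval_eq0 f : (forall u, mxeval f u = 0) -> f = 0.
Proof. by move=> H; apply: mpoly_eq0_eval => v; rewrite mxeval_vec. Qed.

Lemma mxeval_inj f g : mxeval f =1 mxeval g -> f = g.
Proof.
move=> fg; apply/eqP; rewrite -subr_eq0; apply/eqP/mxeval_eq0 => u.
by rewrite /mxeval mevalB -/(mxeval f u) fg subrr.
Qed.

(** Rows and columns are selected by arbitrary maps, so that deleting the first row and column is
    composition with [lift 0], as the induction on the size requires. *)
Definition generic_minor (R : comNzRingType) r (rho : 'I_r -> 'I_a)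
  (sigma : 'I_r -> 'I_b) : {mpoly R[a * b]} :=
  locked (\det (mxsub rho sigma (generic_mx R))).

Lemma generic_minorE (R : comNzRingType) r (rho : 'I_r -> 'I_a) (sigma : 'I_r -> 'I_b) :
  generic_minor R rho sigma = \det (mxsub rho sigma (generic_mx R)).
Proof. by rewrite /generic_minor -lock. Qed.

Lemma mxeval_minor r (rho : 'I_r -> 'I_a) (sigma : 'I_r -> 'I_b) u :
  mxeval (generic_minor K rho sigma) u = \det (mxsub rho sigma u).
Proof.
rewrite /mxeval generic_minorE -det_map_mx; congr (\det _).
by rewrite map_mxsub generic_mx_eval.
Qed.

Lemma mxsub_surj r (rho : 'I_r -> 'I_a) (sigma : 'I_r -> 'I_b) (M : 'M[K]_r) :
  injective rho -> injective sigma -> exists u, mxsub rho sigma u = M.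
Proof.
move=> rI sI; exists (\matrix_(i, j)
  if [pick k | rho k == i] is Some k then
    if [pick l | sigma l == j] is Some l then M k l else 0 else 0).
apply/matrixP => k l; rewrite !mxE.
case: pickP => [k' /eqP/rI->|/(_ k)]; last by rewrite eqxx.
by case: pickP => [l' /eqP/sI->|/(_ l)]; last by rewrite eqxx.
Qed.

Lemma generic_minor_neq0 r (rho : 'I_r -> 'I_a) (sigma : 'I_r -> 'I_b) :
  injective rho -> injective sigma -> generic_minor K rho sigma != 0.
Proof.
move=> rI sI; have [u uE] := mxsub_surj 1%:M rI sI.
apply/eqP => /(congr1 (fun f => mxeval f u)).
by rewrite mxeval_minor uE det1 /mxeval meval0 => /eqP; rewrite oner_eq0.
Qed.

Definition set_entry (i0 : 'I_(a * b)) u (t : K) : 'M[K]_(a, b) :=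
  locked (vec_mx (\row_i if i == i0 then t else mxvec u 0 i)).

Lemma mxvec_set_entry i0 u t i :
  mxvec (set_entry i0 u t) 0 i = if i == i0 then t else mxvec u 0 i.
Proof. by rewrite /set_entry -lock vec_mxK mxE. Qed.

Lemma set_entryE i j u t k l :
  set_entry (mxvec_index i j) u t k l =
  if (k == i) && (l == j) then t else u k l.
Proof.
by rewrite -mxvecE mxvec_set_entry mxvecE mxvec_index_eq.
Qed.

Lemma set_entry_id i j u : set_entry (mxvec_index i j) u (u i j) = u.
Proof.
by apply/matrixP => k l; rewrite set_entryE; case: andP => // -[/eqP-> /eqP->].
Qed.

(** In the expansion along row 0 only the corner term contains the entry, and its cofactor is the
    smaller minor with sign +1. *)
Lemma det_set_entry r (rho : 'I_r.+1 -> 'I_a) (sigma : 'I_r.+1 -> 'I_b) u t :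
  injective rho -> injective sigma ->
  \det (mxsub rho sigma (set_entry (mxvec_index (rho 0) (sigma 0)) u t)) =
  \det (mxsub rho sigma u) + (t - u (rho 0) (sigma 0)) *
  \det (mxsub (rho \o lift 0) (sigma \o lift 0) u).
Proof.
move=> rI sI; rewrite !(expand_det_row _ 0) !big_ord_recl.
rewrite !mxE set_entryE !eqxx /=.
have cof j :
    cofactor (mxsub rho sigma (set_entry (mxvec_index (rho 0) (sigma 0)) u t)) 0 j =
    cofactor (mxsub rho sigma u) 0 j.
  rewrite /cofactor; congr (_ * \det _); apply/matrixP => k l.
  by rewrite !mxE set_entryE (inj_eq rI) eq_sym (negPf (neq_lift _ _)).
rewrite cof addrAC mulrBl; congr (_ + _); last first.
  apply: eq_bigr => j _; rewrite cof !mxE set_entryE eqxx (inj_eq sI).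
  by rewrite eq_sym (negPf (neq_lift _ _)).
rewrite [cofactor _ _ _](_ : _ = \det (mxsub (rho \o lift 0) (sigma \o lift 0) u)).
  by rewrite addrC subrK.
rewrite /cofactor expr0 mul1r; congr (\det _).
by apply/matrixP => k l; rewrite !mxE.
Qed.

Lemma det_set_entry_minor r (rho : 'I_r.+1 -> 'I_a) (sigma : 'I_r.+1 -> 'I_b) u t :
  injective rho ->
  \det (mxsub (rho \o lift 0) (sigma \o lift 0)
     (set_entry (mxvec_index (rho 0) (sigma 0)) u t)) =
  \det (mxsub (rho \o lift 0) (sigma \o lift 0) u).
Proof.
move=> rI; congr (\det _); apply/matrixP => k l.
by rewrite !mxE set_entryE (inj_eq rI) eq_sym (negPf (neq_lift _ _)).
Qed.

(** [p] splits over [K], and all its roots equal [t0]; the zero polynomial has leading coefficient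
    0. *)
Lemma one_root_poly (p : {poly K}) t0 : (forall t, t != t0 -> p.[t] != 0) ->
  p = lead_coef p *: ('X - t0%:P) ^+ (size p).-1.
Proof.
move=> H; have [s ps] := closed_field_poly_normal p.
have [l0|l0] := eqVneq (lead_coef p) 0.
  by rewrite l0 scale0r; apply/eqP; rewrite -lead_coef_eq0 l0.
have sE : s = nseq (size s) t0.
  apply/all_pred1P/allP => z zs /=; apply: contraT => /H; rewrite ps hornerZ.
  by rewrite (rootP _) ?mulr0 ?eqxx // root_prod_XsubC.
have szp : size p = (size s).+1 by rewrite ps size_scale // size_prod_XsubC.
by rewrite szp /= {1}ps {1}sE big_nseq iter_mulr_1.
Qed.

(** The coefficients do not involve the variable [i0], but they stay in the full polynomial ring so
    that they can be evaluated at the same matrices as [g]. *)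
Definition entry_poly (i0 : 'I_(a * b)) g : {poly PR} :=
  mmap (polyC \o @mpolyC _ K) (fun j => if j == i0 then 'X else ('X_j)%:P) g.

Lemma map_entry_poly i0 g u :
  map_poly (meval (mxvec u 0)) (entry_poly i0 g) =
  mmap polyC (fun j => if j == i0 then 'X else (mxvec u 0 j)%:P) g.
Proof.
rewrite /entry_poly (@mmap_comp _ _ _ _ _ (map_poly (meval (mxvec u 0)))).
rewrite /mmap; apply: eq_bigr => m _; congr (_ * _).
  by rewrite /= map_polyC /= mevalC.
by apply: mmap1_eq => j /=; case: ifP; rewrite ?map_polyX // map_polyC /= mevalXU.
Qed.

Lemma map_entry_poly_set i0 g u t :
  map_poly (meval (mxvec (set_entry i0 u t) 0)) (entry_poly i0 g) =
  map_poly (meval (mxvec u 0)) (entry_poly i0 g).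
Proof.
rewrite !map_entry_poly; apply: mmap_eq => j; case: ifP => // ji.
by rewrite mxvec_set_entry ji.
Qed.

Lemma horner_entry_poly i0 g u t :
  (map_poly (meval (mxvec u 0)) (entry_poly i0 g)).[t] = mxeval g (set_entry i0 u t).
Proof.
rewrite map_entry_poly horner_mpath; apply: meval_eq => j.
by rewrite mxvec_set_entry; case: ifP; rewrite ?hornerX ?hornerC.
Qed.

End GenericMatrix.

Section MinorPower.
Variables (K : closedFieldType) (a b : nat).
Local Notation PR := {mpoly K[a * b]}.
Implicit Types (u : 'M[K]_(a, b)) (f g : PR).

Lemma mxevalM f g u : mxeval (f * g) u = mxeval f u * mxeval g u.
Proof. exact: mevalM. Qed.

Lemma mxevalX f k u : mxeval (f ^+ k) u = mxeval f u ^+ k.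
Proof. exact: rmorphXn. Qed.

Lemma mxevalZ c f u : mxeval (c *: f) u = c * mxeval f u.
Proof. exact: mevalZ. Qed.

Lemma set_entry_det_neq0 r (rho : 'I_r.+1 -> 'I_a) (sigma : 'I_r.+1 -> 'I_b) u :
  injective rho -> injective sigma ->
  \det (mxsub (rho \o lift 0) (sigma \o lift 0) u) != 0 ->
  exists t, \det (mxsub rho sigma
    (set_entry (mxvec_index (rho 0) (sigma 0)) u t)) != 0.
Proof.
move=> rI sI a0; set d := \det (mxsub rho sigma u).
set A := \det _ in a0.
exists (u (rho 0) (sigma 0) + (1 - d) / A).
by rewrite det_set_entry // -/A -/d addrAC subrr add0r divfK // addrC subrK oner_eq0.
Qed.

(** Used to compare the exponents of the two minors in [minor_power]. The permutation matrix
    exchanging the first two indices is invertible, but without its first row and column it has a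
    zero row; in size 1 the smaller minor is the empty determinant. *)
Lemma lower_minor_eq1_or_root r (rho : 'I_r.+1 -> 'I_a) (sigma : 'I_r.+1 -> 'I_b) :
  injective rho -> injective sigma ->
  generic_minor K (rho \o lift 0) (sigma \o lift 0) = 1 \/
  exists u, \det (mxsub rho sigma u) != 0 /\
            \det (mxsub (rho \o lift 0) (sigma \o lift 0) u) = 0.
Proof.
case: r rho sigma => [|r] rho sigma rI sI; [left|right].
  by rewrite generic_minorE det_mx00.
pose s : 'S_r.+2 := tperm 0 (lift 0 0).
have [u uE] := mxsub_surj (perm_mx s : 'M[K]_r.+2) rI sI.
exists u; rewrite uE det_perm; split; first by rewrite signr_eq0.
rewrite (_ : mxsub _ _ _ = row' 0 (col' 0 (perm_mx s))); last first.
  by rewrite -uE; apply/matrixP => i j; rewrite !mxE.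
rewrite (expand_det_row _ 0) big1 // => j _; rewrite !mxE.
by rewrite /s tpermR (negPf (neq_lift _ _)) mul0r.
Qed.

(* In the entry x of the first row and column the minor is D = A x + B, with A the
   smaller minor, so g has no root in x other than - B / A and A^k g = lc D^k, where
   lc is the leading coefficient of g in x and k its degree. By induction lc is a
   multiple of a power A^l, and l = k since D may be nonzero where A vanishes. *)
Lemma minor_power r : forall (rho : 'I_r -> 'I_a) (sigma : 'I_r -> 'I_b) g,
  injective rho -> injective sigma ->
  (forall u, \det (mxsub rho sigma u) != 0 -> mxeval g u != 0) ->
  exists c k, c != 0 /\ g = c *: generic_minor K rho sigma ^+ k.
Proof.
elim: r => [|r IH] rho sigma g rI sI H.
  (* The empty determinant is 1, so [g] has no zero at all. On the line of multiples of [u] it is a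
     nowhere vanishing polynomial in one variable, hence constant, equal to its value at 0. *)
  have g0 u : mxeval g u != 0 by apply: H; rewrite det_mx00 oner_eq0.
  exists (mxeval g 0), 0; split=> //.
  apply: mxeval_inj => u; rewrite expr0 mxevalZ /mxeval meval1 mulr1.
  pose p := mmap polyC (fun i => (mxvec u 0 i) *: 'X) g.
  have pE t : p.[t] = mxeval g (t *: u).
    rewrite horner_mpath; apply: meval_eq => i.
    by rewrite hornerZ hornerX linearZ /= mxE mulrC.
  have p0 t : p.[t] != 0 by rewrite pE.
  have := nowhere_zero_poly_const p0 1 0.
  by rewrite !pE scale1r scale0r.
pose i0 := mxvec_index (rho 0) (sigma 0).
pose A := generic_minor K (rho \o lift 0) (sigma \o lift 0).
pose D := generic_minor K rho sigma.
have rI' : injective (rho \o lift 0) by apply: inj_comp => //; apply: lift_inj.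
have sI' : injective (sigma \o lift 0) by apply: inj_comp => //; apply: lift_inj.
pose q := entry_poly i0 g.
pose lc := lead_coef q; pose k := (size q).-1.
pose qu u := map_poly (meval (mxvec u 0)) q.
have AE u : mxeval A u = \det (mxsub (rho \o lift 0) (sigma \o lift 0) u).
  exact: mxeval_minor.
have DE u : mxeval D u = \det (mxsub rho sigma u) by exact: mxeval_minor.
have g0 : g != 0.
  have [u uE] := mxsub_surj (1%:M : 'M[K]_r.+1) rI sI.
  have /H : \det (mxsub rho sigma u) != 0 by rewrite uE det1 oner_eq0.
  by apply: contraNneq => ->; rewrite /mxeval meval0.
have lc0 : lc != 0.
  rewrite lead_coef_eq0; apply: contraNneq g0 => q0.
  apply/eqP/mxeval_eq0 => u.
  rewrite -(set_entry_id (rho 0) (sigma 0) u) -horner_entry_poly -/i0 -/q q0.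
  by rewrite map_poly0 horner0.
have A0 : A != 0 by apply: generic_minor_neq0.
have D0 : D != 0 by apply: generic_minor_neq0.
have key u : mxeval A u != 0 -> mxeval lc u != 0 ->
    mxeval A u ^+ k * mxeval g u = mxeval lc u * mxeval D u ^+ k.
  move=> Au lu; set x := u (rho 0) (sigma 0).
  pose t0 := x - mxeval D u / mxeval A u.
  have root1 t : t != t0 -> (qu u).[t] != 0.
    move=> tt0; rewrite horner_entry_poly; apply: H.
    rewrite det_set_entry // -AE -DE -/x; apply: contraNneq tt0 => e.
    have e1 : (t - x) * mxeval A u = - mxeval D u.
      by apply/eqP; rewrite -addr_eq0 addrC; apply/eqP.
    by rewrite /t0 -mulNr -e1 mulfK // addrC subrK.
  have szq : size (qu u) = size q by rewrite size_map_poly_id0.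
  have lq : lead_coef (qu u) = mxeval lc u by rewrite lead_coef_map_id0 // meval0.
  have := one_root_poly root1; rewrite lq szq -/k => quE.
  have := congr1 (horner^~ x) quE; rewrite /= horner_entry_poly set_entry_id => ->.
  rewrite hornerZ horner_exp hornerXsubC /t0 opprB addrC subrK.
  by rewrite mulrCA -exprMn [_ * (_ / _)]mulrCA mulfV // mulr1.
have Eq : A ^+ k * g = lc * D ^+ k.
  (* [key] gives the identity only where [A] and [lc] are nonzero. Multiplied by [A * lc], the
     difference vanishes everywhere, and the factor is then cancelled. *)
  have Alc : A * lc != 0 by rewrite mulf_neq0.
  apply/eqP; rewrite -subr_eq0 -(mulrI_eq0 _ (mulfI Alc)).
  apply/eqP/mxeval_eq0 => u.
  rewrite !mxevalM /mxeval mevalB -!/(mxeval _ u) !mxevalM !mxevalX.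
  have [->|Au] := eqVneq (mxeval A u) 0; first by rewrite !mul0r.
  have [->|lu] := eqVneq (mxeval lc u) 0; first by rewrite mulr0 !mul0r.
  by rewrite (key u) // subrr mulr0.
(* Neither [A] nor [lc] depends on the corner entry, so that entry may be changed to make [D]
   nonzero; there [g] is nonzero, and [Eq] forces [lc] to be nonzero. *)
have lcH u : \det (mxsub (rho \o lift 0) (sigma \o lift 0) u) != 0 -> mxeval lc u != 0.
  move=> Au; have [t Dt] := set_entry_det_neq0 rI sI Au.
  pose u' := set_entry i0 u t.
  have lcE : mxeval lc u' = mxeval lc u.
    have := congr1 (fun p : {poly K} => p`_k) (map_entry_poly_set i0 g u t).
    by rewrite !coef_map.
  have := congr1 (fun f => mxeval f u') Eq.
  rewrite !mxevalM !mxevalX lcE => e.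
  have : mxeval A u' ^+ k * mxeval g u' != 0.
    by rewrite mulf_neq0 ?H // expf_neq0 // AE det_set_entry_minor.
  by rewrite e mulf_eq0 negb_or => /andP[].
have [c [l [c0 lcE]]] := IH _ _ lc rI' sI' lcH.
have {}Eq : A ^+ k * g = c *: (A ^+ l * D ^+ k) by rewrite Eq lcE -scalerAl.
exists c, k; split=> //; rewrite -/D.
have [lk|lk|lk] := ltngtP l k; last first.
- have /mulfI : A ^+ k != 0 by rewrite expf_neq0.
  by apply; rewrite Eq lk -scalerAr.
- have gE : g = c *: (A ^+ (l - k) * D ^+ k).
    have /mulfI : A ^+ k != 0 by rewrite expf_neq0.
    by apply; rewrite Eq -scalerAr mulrA -exprD subnKC // ltnW.
  have [A1|[u [Du Au]]] := lower_minor_eq1_or_root rI sI.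
    by rewrite gE /A A1 expr1n mul1r.
  have := H _ Du; rewrite gE mxevalZ mxevalM !mxevalX AE Au.
  by rewrite expr0n subn_eq0 leqNgt lk mul0r mulr0 eqxx.
have gE : A ^+ (k - l) * g = c *: D ^+ k.
  have /mulfI : A ^+ l != 0 by rewrite expf_neq0.
  by apply; rewrite mulrA -exprD subnKC ?(ltnW lk) // Eq -scalerAr.
have [A1|[u [Du Au]]] := lower_minor_eq1_or_root rI sI.
  by rewrite -gE /A A1 expr1n mul1r.
have := congr1 (fun f => mxeval f u) gE.
rewrite mxevalZ mxevalM !mxevalX AE Au expr0n subn_eq0 leqNgt lk mul0r.
by move/esym/eqP; rewrite mulf_eq0 (negPf c0) expf_eq0 DE (negPf Du) andbF.
Qed.

Lemma mxeval_unit f : f \is a GRing.unit -> forall u, mxeval f u != 0.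
Proof. by move=> fU u; rewrite -unitfE; apply: (rmorph_unit (meval _)). Qed.

Lemma mpoly_scalar_unit c : c != 0 -> (c *: 1 : PR) \is a GRing.unit.
Proof.
move=> c0; apply/unitrP; exists (c^-1 *: 1).
by rewrite -!scalerAl !mul1r !scalerA mulfV // mulVf // scale1r.
Qed.

Variables (r : nat) (rho : 'I_r.+1 -> 'I_a) (sigma : 'I_r.+1 -> 'I_b).
Hypotheses (rI : injective rho) (sI : injective sigma).
Let D := generic_minor K rho sigma.

Lemma generic_minor_nonunit : D \isn't a GRing.unit.
Proof.
have [u uE] := mxsub_surj (0 : 'M[K]_r.+1) rI sI.
by apply/negP => /mxeval_unit/(_ u); rewrite mxeval_minor uE det0 eqxx.
Qed.

(** Each factor is nonzero wherever [D] is, hence a scalar multiple of a power of [D]. If both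
    exponents were positive, [D] would be a unit. *)
Lemma generic_minor_irreducible : irreducible_mpoly D.
Proof.
split=> [|g h Dgh]; first exact: generic_minor_nonunit.
have D0 : D != 0 by apply: generic_minor_neq0.
have [c [k [c0 gE]]] : exists c k, c != 0 /\ g = c *: D ^+ k.
  apply: minor_power => // u; rewrite -mxeval_minor -/D Dgh mxevalM.
  by rewrite mulf_eq0 negb_or => /andP[].
have [e [l [e0 hE]]] : exists c k, c != 0 /\ h = c *: D ^+ k.
  apply: minor_power => // u; rewrite -mxeval_minor -/D Dgh mxevalM.
  by rewrite mulf_eq0 negb_or => /andP[].
case: k gE => [|k] gE; first by left; rewrite gE mpoly_scalar_unit.
case: l hE => [|l] hE; first by right; rewrite hE mpoly_scalar_unit.
have DD : D * ((c * e) *: (D ^+ k * D ^+ l)) = 1.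
  apply: (mulfI D0); rewrite mulr1 [in RHS]Dgh gE hE -!scalerAr -!scalerAl scalerA.
  by rewrite [e * c]mulrC !exprS mulrACA -!mulrA.
case/negP: generic_minor_nonunit; apply/unitrP.
by exists ((c * e) *: (D ^+ k * D ^+ l)); rewrite [in X in X /\ _]mulrC.
Qed.

(** By [minor_power], [g] is a multiple of a power of [D]; irreducibility excludes the exponent 0
    and all exponents above 1. *)
Lemma irreducible_eq_minor g : irreducible_mpoly g ->
  (forall u, \det (mxsub rho sigma u) != 0 -> mxeval g u != 0) ->
  exists2 c, c != 0 & g = c *: D.
Proof.
move=> [gN gI] H; have [c [[|[|k]] [c0 gE]]] := minor_power rI sI H.
- by rewrite gE mpoly_scalar_unit in gN.
- by exists c; rewrite // gE expr1.
have [] := gI (c *: D) (D ^+ k.+1); first by rewrite gE exprS -scalerAl.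
  move=> /mxeval_unit HH; have [u uE] := mxsub_surj (0 : 'M[K]_r.+1) rI sI.
  by have := HH u; rewrite mxevalZ mxeval_minor uE det0 mulr0 eqxx.
by rewrite unitrX_pos // (negPf generic_minor_nonunit).
Qed.

End MinorPower.

(** * Weighted homogeneous factors *)

(** Split off from [p] and [q] their powers of ['X]. The cofactors have nonzero constant terms,
    which forces the two powers to add up to [a]; the product of the cofactors is then the constant
    [c], so they are constants. *)
Lemma factor_monomial (R : idomainType) (p q : {poly R}) c a :
  c != 0 -> p * q = c%:P * 'X^a -> exists b, forall k, p`_k != 0 -> k = b.
Proof.
move=> c0 pq.
have : p * q != 0 by rewrite pq mulf_neq0 ?polyC_eq0 // monic_neq0 // monicXn.
rewrite mulf_eq0 negb_or => /andP[p0 q0].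
have [i [p1 p1N pE]] := multiplicity_XsubC p 0.
have [j [q1 q1N qE]] := multiplicity_XsubC q 0.
rewrite p0 subr0 rootE /= in p1N pE; rewrite q0 subr0 rootE /= in q1N qE.
have pq1 : p1 * q1 * 'X^(i + j) = c%:P * 'X^a by rewrite -pq pE qE mulrACA exprD.
have ij : (i + j)%N = a.
  have := congr1 (fun r : {poly R} => r`_(i + j)) pq1.
  rewrite /= coefMXn ltnn subnn -horner_coef0 hornerM coefCM coefXn => e.
  apply/eqP; apply: contraT => ne; move/eqP: e.
  by rewrite (negPf ne) mulr0 mulf_eq0 (negPf p1N) (negPf q1N).
have {}pq1 : p1 * q1 = c%:P.
  by apply: (mulIf (monic_neq0 (monicXn R a))); rewrite -pq1 ij.
have sp1 : size p1 = 1%N.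
  have : size (p1 * q1) = 1%N by rewrite pq1 size_polyC c0.
  have nz (q' : {poly R}) : ~~ (q'.[0] == 0) -> q' != 0.
    by apply: contraNneq => ->; rewrite horner0.
  rewrite size_mul ?nz //.
  have := size_poly_gt0 q1; have := size_poly_gt0 p1; rewrite !nz //.
  by case: (size p1) (size q1) => [|[|s1]] [|[|s2]] // _ _; rewrite addSn addnS.
exists i => k; rewrite pE coefMXn; case: ltnP; rewrite ?eqxx // => ik.
have [->|] := eqVneq k i; first by [].
move=> ne /negP[]; rewrite nth_default // sp1 subn_gt0 ltn_neqAle eq_sym ne ik //.
Qed.

Section HomogFactor.
Variables (R : idomainType) (n : nat) (mf : measure n).
Implicit Types f g : {mpoly R[n]}.

(** A new variable records the weight of each monomial. This is a ring morphism whose coefficients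
    are the weighted homogeneous components. *)
Let grade f : {poly {mpoly R[n]}} :=
  mmap (polyC \o @mpolyC n R) (fun i => 'X_i *: 'X^(mf U_(i)%MM)) f.

Let grade_coef f k : (grade f)`_k = pihomog mf k f.
Proof.
rewrite /grade /mmap coef_sum pihomogE [RHS]big_mkcond /=; apply: eq_bigr => m _.
have -> : mmap1 (fun i => 'X_i *: 'X^(mf U_(i)%MM)) m =
          'X_[m] *: 'X^(mf m) :> {poly {mpoly R[n]}}.
  rewrite /mmap1; under eq_bigr do rewrite exprZn -exprM mulnC.
  rewrite scaler_prod -mpolyXE_id -[X in _ *: X = _](big_morph _ (exprD 'X) (expr0 _)).
  by rewrite [in RHS](mfE mf).
rewrite -mul_polyC mulrA -polyCM coefCM coefXn eq_sym mul_mpolyC.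
by case: eqP => _; rewrite ?mulr1 ?mulr0.
Qed.

(** [grade] turns a homogeneous product into a monomial in the new variable, over a domain, where
    [factor_monomial] applies. *)
Lemma homog_factor f g d : f * g != 0 -> f * g \is d.-homog for mf ->
  exists e, f \is e.-homog for mf.
Proof.
move=> fg0 fgH.
have gfg : grade f * grade g = (f * g)%:P * 'X^d.
  rewrite -[LHS](rmorphM (mmap _ _)); apply/polyP => k.
  rewrite [LHS]grade_coef coefCM coefXn.
  have [->|ne] := eqVneq k d; first by rewrite mulr1 pihomog_dE.
  by rewrite mulr0 (@pihomog_ne0 _ _ mf d) // eq_sym.
have [b bP] := factor_monomial fg0 gfg; exists b.
apply/dhomogP => m mf_m; apply: bP; rewrite grade_coef.
have : (pihomog mf (mf m) f)@_m != 0.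
  rewrite pihomogE raddf_sum big_mkcond (bigD1_seq m) ?msupp_uniq //= eqxx.
  rewrite mcoeffZ mcoeffX eqxx mulr1 big1 ?addr0 -?mcoeff_msupp // => m' ne.
  by case: ifP => // _; rewrite mcoeffZ mcoeffX (negPf ne) mulr0.
by apply: contraNneq => ->; rewrite mcoeff0.
Qed.

End HomogFactor.

Section ColumnWeight.
Variables a b : nat.

(** The degree in the variables of column [j], that is, the weight for the one-parameter subgroup
    scaling this column. *)
Definition colw (j : 'I_b) (m : 'X_{1..a * b}) : nat :=
  (\sum_i m (mxvec_index i j))%N.

Lemma colw0 j : colw j 0%MM = 0%N.
Proof. by rewrite /colw big1 // => i _; rewrite mnm0E. Qed.

Lemma colwD j : {morph colw j : m1 m2 / (m1 + m2)%MM >-> (m1 + m2)%N}.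
Proof.
by move=> m1 m2; rewrite /colw -big_split; apply: eq_bigr => i _; rewrite mnmDE.
Qed.

HB.instance Definition _ j := isMeasure.Build _ (colw j) (colw0 j) (colwD j).

Definition col_homog (R : nzRingType) (f : {mpoly R[a * b]}) :=
  forall j, exists d, f \is d.-homog for (colw j).

Lemma col_homog_factor (R : idomainType) (f g : {mpoly R[a * b]}) :
  f * g != 0 -> col_homog (f * g) -> col_homog f.
Proof. by move=> fg0 fgH j; have [d /(homog_factor fg0)] := fgH j. Qed.

Lemma meval_col_scale (R : comNzRingType) (f : {mpoly R[a * b]})
    (u : 'M[R]_(a, b)) (t : 'rV[R]_b) :
  f.@[mxvec (u *m diag_mx t) 0] =
  \sum_(m <- msupp f) f@_m * (\prod_j t 0 j ^+ colw j m) * \prod_k mxvec u 0 k ^+ m k.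
Proof.
rewrite mevalE; apply: eq_bigr => m _; rewrite -mulrA; congr (_ * _).
have reidx (F : 'I_(a * b) -> R) : \prod_k F k = \prod_i \prod_j F (mxvec_index i j).
  rewrite pair_bigA /= [LHS](reindex _ (curry_mxvec_bij _ _)) /=.
  by apply: eq_bigr => -[i j].
rewrite !reidx.
under eq_bigr do under eq_bigr do rewrite mxvecE mul_mx_diag mxE exprMn.
under eq_bigr do rewrite big_split /=.
rewrite big_split mulrC /=; congr (_ * _).
  by apply: eq_bigr => i _; apply: eq_bigr => j _; rewrite mxvecE.
rewrite exchange_big /=; apply: eq_bigr => j _.
by rewrite (big_morph _ (exprD _) (expr0 _)).
Qed.

Lemma col_homog_eval (R : comNzRingType) (f : {mpoly R[a * b]}) : col_homog f ->
  exists e : 'I_b -> nat, forall (u : 'M[R]_(a, b)) (t : 'rV[R]_b),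
    f.@[mxvec (u *m diag_mx t) 0] = (\prod_j t 0 j ^+ e j) * f.@[mxvec u 0].
Proof.
move=> fH; have [e eP] : exists e : 'I_b -> nat, forall j, f \is (e j).-homog for (colw j).
  by have [e] := boolp.choice fH; exists e.
exists e => u t; rewrite meval_col_scale mevalE mulr_sumr.
rewrite big_seq [RHS]big_seq; apply: eq_bigr => m ms.
rewrite mulrAC mulrC; congr (_ * _); apply: eq_bigr => j _.
by rewrite (dhomogP _ _ _ (eP j) m ms).
Qed.

End ColumnWeight.

(** * Cones and the dimension of coordinate subspaces *)

Section Cones.
Variables (K : closedFieldType) (n : nat).
Local Notation rV := 'rV[K]_n.+1.
Local Notation PR := {mpoly K[n.+1]}.
Implicit Types (x y : rV) (f g h : PR) (Z : set (pspace K n)).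

Lemma proj_eq (k : fieldType) (V : vectType k) (P Q : proj V) :
  line P = line Q -> P = Q.
Proof.
case: P Q => [U dU] [W dW] /= UW; case: W / UW dW => dW.
by rewrite (eq_irrelevance dU dW).
Qed.

Lemma dim_point (k : fieldType) (V : vectType k) (x : V) : x != 0 -> \dim <[x]> = 1%N.
Proof. by rewrite dim_vline => ->. Qed.

Definition point (k : fieldType) (V : vectType k) (x : V) (x0 : x != 0) : proj V :=
  Proj (dim_point x0).

Lemma proj_line (k : fieldType) (V : vectType k) (P : proj V) (x : V) :
  x != 0 -> x \in line P -> line P = <[x]>%VS.
Proof.
move=> x0 xP; apply/esym/eqP; rewrite eqEdim dim_line dim_vline x0 andbT.
by rewrite -memvE.
Qed.

Lemma proj_pick (k : fieldType) (V : vectType k) (P : proj V) :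
  exists2 x, x != 0 & x \in line P.
Proof.
exists (vpick (line P)); last exact: memv_pick.
by rewrite vpick0 -dimv_eq0 dim_line.
Qed.

Lemma homog_scale f e c x : f \is e.-homog ->
  f.@[(c *: x) 0] = c ^+ e * f.@[x 0].
Proof.
move=> fH; rewrite !mevalE mulr_sumr big_seq [RHS]big_seq; apply: eq_bigr => m ms.
rewrite mulrCA; congr (_ * _); rewrite -(dhomogP _ _ _ fH m ms) /= mdegE.
rewrite -prodrXr -big_split; apply: eq_bigr => j _.
by rewrite /= mxE exprMn.
Qed.

(** Homogeneous polynomials have values at vectors, not at points, so the geometry is carried out
    with the nonzero vectors over [Z]. *)
Definition cone Z : set rV := [set x | x != 0 /\ exists2 P, Z P & x \in line P].

Lemma cone_point Z x (x0 : x != 0) : cone Z x <-> Z (point x0).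
Proof.
split=> [[_ [P ZP xP]]|ZP]; last by split=> //; exists (point x0); rewrite //= memv_line.
by rewrite (_ : point x0 = P) //; apply: proj_eq; rewrite /= (proj_line x0 xP).
Qed.

Lemma cone_scale Z x c : c != 0 -> cone Z x -> cone Z (c *: x).
Proof.
move=> c0 [x0 [P ZP xP]]; split; first by rewrite scaler_eq0 negb_or c0.
by exists P; rewrite // memvZ.
Qed.

Lemma cone_sub Z Z' : Z `<=` Z' <-> cone Z `<=` cone Z'.
Proof.
split=> [ZZ x [x0 [P ZP xP]]|ZZ P ZP]; first by split=> //; exists P => //; apply: ZZ.
have [x x0 xP] := proj_pick P.
have -> : P = point x0 by apply: proj_eq; rewrite (proj_line x0 xP).
by apply/cone_point/ZZ; split=> //; exists P.
Qed.

Lemma cone_neq0 Z : Z !=set0 -> exists x, cone Z x.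
Proof. by move=> [P ZP]; have [x x0 xP] := proj_pick P; exists x; split=> //; exists P. Qed.

Definition vanish f Z := forall x, cone Z x -> f.@[x 0] = 0.

Lemma zero_locus_cone (E : set PR) : (forall f, E f -> exists e : nat, f \is e.-homog) ->
  forall x, cone (zero_locus E) x <-> x != 0 /\ forall f, E f -> f.@[x 0] = 0.
Proof.
move=> EH x; split=> [[x0 [P PE xP]]|[x0 xE]]; first by split=> // f Ef; apply: PE.
apply/(cone_point _ x0) => f y Ef /= /vlineP[c ->].
by have [e fe] := EH f Ef; rewrite (homog_scale _ _ fe) xE // mulr0.
Qed.

Lemma sub_zero_locus (E : set PR) Z : (forall f, E f -> exists e : nat, f \is e.-homog) ->
  Z `<=` zero_locus E <-> forall f, E f -> vanish f Z.
Proof.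
move=> EH; rewrite cone_sub; split=> [H f Ef x /H /(zero_locus_cone EH)[_]|H x Zx].
  exact.
by apply/(zero_locus_cone EH); split=> [|f Ef]; [case: Zx | apply: H].
Qed.

Lemma subvariety_prime Z f g d e : subvariety Z -> f \is d.-homog -> g \is e.-homog ->
  vanish (f * g) Z -> vanish f Z \/ vanish g Z.
Proof.
move=> [_ _ Zirr] fd ge fgZ.
have H1 h k : h \is k.-homog -> forall f, [set h] f -> exists e : nat, f \is e.-homog.
  by move=> hk _ ->; exists k.
have H2 h k : h \is k.-homog -> zariski_closed (zero_locus [set h]).
  by move=> hk; exists [set h] => //; apply: H1 hk.
have [] := Zirr _ _ (H2 _ _ fd) (H2 _ _ ge).
- move=> P ZP; have [x x0 xP] := proj_pick P.
  have -> : P = point x0 by apply: proj_eq; rewrite (proj_line x0 xP).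
  have Zx : cone Z x by split=> //; exists P.
  have /eqP := fgZ _ Zx; rewrite mevalM mulf_eq0 => /orP[] /eqP h0; [left|right].
    by apply/cone_point/(zero_locus_cone (H1 _ _ fd)); split=> // _ ->.
  by apply/cone_point/(zero_locus_cone (H1 _ _ ge)); split=> // _ ->.
- by move/(sub_zero_locus _ (H1 _ _ fd)) => H; left; apply: H.
- by move/(sub_zero_locus _ (H1 _ _ ge)) => H; right; apply: H.
Qed.

Lemma poly_eq0_torus (p : {poly K}) : (forall t, t != 0 -> p.[t] = 0) -> p = 0.
Proof.
move=> H; apply/eqP; apply: contraT => p0.
have /horner_nonroot[t] : p * 'X != 0 by rewrite mulf_neq0 ?polyX_eq0.
by rewrite hornerM hornerX mulf_eq0 negb_or => /andP[pt /H pt0]; rewrite pt0 eqxx in pt.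
Qed.

(** [h] need not be homogeneous. On the multiples t x of a vector of the cone, f h is, up to a power
    of t, a polynomial in t whose coefficients are the values at x of f times the components of [h].
    It vanishes for all t != 0, so every such product vanishes on [Z] and primality applies to each
    component. *)
Lemma subvariety_cancel Z f h d : subvariety Z -> f \is d.-homog -> ~ vanish f Z ->
  vanish (f * h) Z -> vanish h Z.
Proof.
move=> ZV fd fZ fhZ.
have hE := pihomog_partitionE (leqnn (msize h)).
have homZ (k : 'I_(msize h)) : vanish (pihomog mdeg k h) Z.
  have [] // := subvariety_prime (f := f) ZV fd (pihomogP mdeg k h).
  move=> x Zx; rewrite mevalM.
  pose p := \poly_(k < msize h) (f.@[x 0] * (pihomog mdeg k h).@[x 0]).
  suff p0 : p = 0.
    by have := congr1 (fun q : {poly K} => q`_k) p0; rewrite coef_poly ltn_ord coef0.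
  apply: poly_eq0_torus => t t0; rewrite horner_poly.
  have /eqP := fhZ _ (cone_scale t0 Zx).
  rewrite mevalM (homog_scale _ _ fd) -mulrA mulf_eq0 expf_eq0 (negPf t0) andbF /=.
  move=> /eqP ht0; rewrite -[RHS]ht0.
  rewrite [in RHS]hE raddf_sum mulr_sumr; apply: eq_bigr => i _.
  by rewrite /= (homog_scale _ _ (pihomogP mdeg i h)) -mulrA [_ * t ^+ _]mulrC.
by move=> x Zx; rewrite hE raddf_sum /= big1 // => k _; apply: homZ.
Qed.

(** Linear independence of the induced functions on the affine cone. The sizes of such families in
    bounded degree stand in for the Hilbert function of [Z]. *)
Definition cone_free Z (I : finType) (e : I -> PR) :=
  forall c : I -> K, vanish (\sum_i c i *: e i) Z -> forall i, c i = 0.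

Lemma msizeM_le f g d e :
  (msize f <= d.+1 -> msize g <= e.+1 -> msize (f * g) <= (d + e).+1)%N.
Proof.
have [->|f0] := eqVneq f 0; first by rewrite mul0r msize0.
have [->|g0] := eqVneq g 0; first by rewrite mulr0 msize0.
rewrite msizeM //; have := msize_poly_eq0 f; have := msize_poly_eq0 g.
rewrite (negPf f0) (negPf g0); case: (msize f) (msize g) => [|a] [|b] // _ _.
by rewrite !ltnS addSn addnS /= ltnS; apply: leq_add.
Qed.

Lemma msizeX_le f d k : (msize f <= d.+1 -> msize (f ^+ k) <= (k * d).+1)%N.
Proof.
move=> fd; elim: k => [|k IH]; first by rewrite expr0 msize1.
by rewrite exprS mulSn; apply: msizeM_le.
Qed.

(** Scaling a vector with nonzero [j]-th coordinate makes a relation between the powers of ['X_j] a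
    polynomial in the scalar that vanishes on the torus. *)
Lemma cone_free_point Z : Z !=set0 -> exists j : 'I_n.+1, forall B : nat,
  cone_free Z (fun b : 'I_B => 'X_j ^+ b : PR).
Proof.
move=> /cone_neq0[x Zx]; have [x0 _] := Zx.
have [j xj] := rV_neq0_coord x0.
exists j => B c cZ b.
pose p := \poly_(b < B) (\sum_(i < B | i == b :> nat) c i * x 0 j ^+ b).
have p0 : p = 0.
  apply: poly_eq0_torus => t t0; rewrite horner_poly -[RHS](cZ _ (cone_scale t0 Zx)).
  rewrite raddf_sum; apply: eq_bigr => i _.
  rewrite (big_pred1 i) //= mevalZ rmorphXn /= mevalXU mxE exprMn -mulrA.
  by congr (_ * _); rewrite mulrC.
have := congr1 (fun q : {poly K} => q`_b) p0.
rewrite coef_poly ltn_ord coef0 (big_pred1 b) // => /eqP.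
by rewrite mulf_eq0 expf_eq0 (negPf xj) andbF orbF => /eqP.
Qed.

(** Let b be the lowest power of [f] in a relation on [Z']. Cancel f^b on [Z'], then restrict to
    [Z], where [f] is zero: only the terms with exponent b survive, and independence on [Z] kills
    them. Induction on b does the rest. *)
Lemma cone_free_step Z Z' f d (I : finType) (e : I -> PR) B :
  subvariety Z' -> Z `<=` Z' -> f \is d.-homog -> vanish f Z -> ~ vanish f Z' ->
  cone_free Z e -> cone_free Z' (fun ib : I * 'I_B => e ib.1 * f ^+ ib.2).
Proof.
move=> Z'V ZZ fd fZ fZ' eZ c cZ'.
have cancel k h : vanish (f ^+ k * h) Z' -> vanish h Z'.
  elim: k => [|k IH]; first by rewrite expr0 mul1r.
  by rewrite exprS -mulrA => /(subvariety_cancel Z'V fd fZ').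
have cone_ZZ := (cone_sub Z Z').1 ZZ.
suff H b i : c (i, b) = 0 by move=> [i b].
have [k] := ubnP (b : nat); elim: k b i => // k IH b i bk.
pose h := \sum_(ib : I * 'I_B | (b <= ib.2)%N) c ib *: (e ib.1 * f ^+ (ib.2 - b)).
have hZ' : vanish h Z'.
  apply: (cancel b) => x Zx; rewrite -[RHS](cZ' x Zx); congr (_.@[_]).
  rewrite (bigID (fun ib : I * 'I_B => (b <= ib.2)%N)) /= [X in _ + X]big1 ?addr0.
    rewrite mulr_sumr; apply: eq_bigr => -[i' b'] /= bb'.
    by rewrite -scalerAr mulrCA -exprD subnKC.
  move=> [i' b']; rewrite -ltnNge /= => b'b.
  by rewrite IH ?scale0r // (leq_trans b'b).
apply: (eZ (fun i => c (i, b))) => x Zx.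
rewrite -[RHS](hZ' x (cone_ZZ x Zx)) /h !raddf_sum /=.
rewrite [RHS](bigID (fun ib : I * 'I_B => ib.2 == b)) /= [X in _ + X]big1 ?addr0; last first.
  move=> [i' b'] /andP[/= bb' ne]; rewrite mevalZ mevalM rmorphXn /= (fZ x Zx).
  by rewrite expr0n subn_eq0 leqNgt ltn_neqAle eq_sym ne bb' /= !mulr0.
rewrite [RHS](reindex_onto (fun i => (i, b)) fst) /=; last first.
  by move=> [i' b'] /= /andP[_ /eqP->].
apply: eq_big => [i'|i' _]; first by rewrite leqnn !eqxx.
by rewrite subnn expr0 mulr1.
Qed.

(* Each inclusion of the chain multiplies the family by the powers f^b, b < B, of
   a form f vanishing on the smaller variety only: B^(s+1) linearly independent
   polynomials of degree O(B) then exist on Z, too many if s is at least the number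
   of coordinates. *)
Lemma chain_cone_free Z s : has_chain Z s -> exists D : nat, forall B : nat,
  exists (I : finType) (e : I -> PR),
    [/\ #|I| = (B ^ s.+1)%N, cone_free Z e & forall i, (msize (e i) <= (D * B).+1)%N].
Proof.
move=> [c [cV cc cZ]].
have mono Z1 Z2 (I : finType) (e : I -> PR) :
    Z1 `<=` Z2 -> cone_free Z1 e -> cone_free Z2 e.
  by move=> /cone_sub Z12 eZ a aZ; apply: eZ => x /Z12; apply: aZ.
suff [D DP] : exists D : nat, forall B : nat, exists (I : finType) (e : I -> PR),
    [/\ #|I| = (B ^ s.+1)%N, cone_free (c s) e & forall i, (msize (e i) <= (D * B).+1)%N].
  exists D => B; have [I [e [Ic eZ De]]] := DP B.
  by exists I, e; split=> //; apply: mono eZ.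
elim: s cV cc {cZ} => [|s IH] cV cc.
  have [_ c0 _] := cV 0%N isT; have [j jP] := cone_free_point c0.
  exists 1%N => B; exists 'I_B, (fun b : 'I_B => 'X_j ^+ b : PR).
  split=> [||b]; [by rewrite card_ord expn1 | exact: jP |].
  have := @msizeX_le 'X_j 1 b; rewrite msizeX mdeg1 muln1 => /(_ isT) h.
  by rewrite (leq_trans h) // ltnS mul1n ltnW.
have [||D DP] := IH.
- by move=> i si; apply: cV; rewrite leqW.
- by move=> i si; apply: cc; rewrite leqW.
have [css ncss] := cc s (ltnSn s).
have [E EH csE] : zariski_closed (c s) by have [] := cV s (leqnSn s).
have [f [Ef fN]] : exists f, E f /\ ~ vanish f (c s.+1).
  apply: contrapT => H; apply: ncss; rewrite csE; apply/(sub_zero_locus _ EH) => f Ef.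
  by apply: contrapT => fN; apply: H; exists f.
have [d fd] := EH f Ef.
have fZ : vanish f (c s) by apply: (sub_zero_locus _ EH).1 Ef; rewrite csE.
(* Multiplying by f^b with b < B raises the degree by at most [msize f * B]. *)
exists (D + msize f)%N => B; have [I [e [Ic eZ De]]] := DP B.
exists (I * 'I_B)%type, (fun ib : I * 'I_B => e ib.1 * f ^+ ib.2); split.
- by rewrite card_prod Ic card_ord -expnSr.
- exact: (cone_free_step (cV _ (leqnn _)) css fd fZ fN eZ).
move=> [i b] /=; rewrite mulnDl; apply: msizeM_le => //.
apply: leq_trans (msizeX_le _ (leqnSn _)) _.
by rewrite ltnS mulnC leq_mul2l ltnW ?orbT.
Qed.

(** On the cone only monomials in the coordinates of [J] are nonzero, and with exponents below [M]
    there are [M ^ #|J|] of them. A larger family has a left kernel vector in its matrix of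
    coefficients at these monomials, hence a relation on the cone. *)
Lemma cone_free_card Z (I : finType) (e : I -> PR) (J : {set 'I_n.+1}) M :
  (forall x, cone Z x -> forall j, j \notin J -> x 0 j = 0) ->
  cone_free Z e -> (forall i, (msize (e i) <= M)%N) -> (#|I| <= M ^ #|J|)%N.
Proof.
move=> ZJ eZ eM; pose T : finType := {ffun {j | j \in J} -> 'I_M}.
have <- : #|T| = (M ^ #|J|)%N by rewrite card_ffun card_sig card_ord.
pose mon (t : T) : 'X_{1..n.+1} :=
  [multinom (if insub j is Some k then t k : nat else 0%N) | j < n.+1].
pose A : 'M[K]_(#|I|, #|T|) := \matrix_(i, t) (e (enum_val i))@_(mon (enum_val t)).
rewrite leqNgt; apply/negP => TI.
have /rowV0Pn[v /sub_kermxP vA v0] : kermx A != 0.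
  rewrite kermx_eq0 /row_free neq_ltn (leq_ltn_trans (rank_leq_col _)) //.
case/negP: v0; apply/eqP/rowP => i; rewrite mxE.
pose c i := v 0 (enum_rank i).
have cE : c (enum_val i) = v 0 i by rewrite /c enum_valK.
rewrite -cE; apply: eZ => x Zx; set p := \sum_i _.
have pM : (msize p <= M)%N.
  apply: leq_trans (msize_sum _ _ _) _; apply/bigmax_leqP => k _.
  have [->|ck] := eqVneq (c k) 0; first by rewrite scale0r msize0.
  by rewrite msizeZ.
rewrite mevalE big_seq big1 // => m mp.
have [/forallP mJ|] := boolP [forall j, (j \notin J) ==> (m j == 0%N)].
  have mlt j : (m j < M)%N.
    apply: leq_trans (leq_trans (msize_mdeg_lt mp) pM); rewrite ltnS mdegE.
    by rewrite (bigD1 j) //= leq_addr.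
  pose t : T := [ffun k => Ordinal (mlt (val k))].
  have mE : m = mon t.
    apply/mnmP => j; rewrite mnmE; case: insubP => [k _ kj|/(implyP (mJ j))/eqP //].
    by rewrite ffunE /= -kj.
  have := congr1 (fun w : 'rV__ => w 0 (enum_rank t)) vA; rewrite !mxE => p0.
  have : p@_m = 0.
    rewrite -[RHS]p0 /p raddf_sum /= (reindex _ (onW_bij _ (enum_val_bij I))) /=.
    apply: eq_bigr => k _; rewrite mcoeffZ mxE enum_rankK -mE; congr (_ * _).
    by rewrite /c enum_valK.
  by move=> ->; rewrite mul0r.
rewrite negb_forall => /existsP[j]; rewrite negb_imply => /andP[jJ mj].
by rewrite (bigD1 j) //= (ZJ x) // expr0n (negPf mj) mul0r mulr0.
Qed.

Theorem chain_length_bound Z s (J : {set 'I_n.+1}) : has_chain Z s ->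
  (forall x, cone Z x -> forall j, j \notin J -> x 0 j = 0) -> (s < #|J|)%N.
Proof.
move=> /chain_cone_free[D DP] ZJ; rewrite ltnNge; apply/negP => Js.
(* [B] exceeds (D + 1)^|J|, so (D B + 1)^|J| <= (D + 1)^|J| B^|J| < B^(|J| + 1) <= B^(s + 1),
   against the upper bound. *)
pose B := (D.+1 ^ #|J|).+1; have [I [e [Ic eZ eD]]] := DP B.
have := cone_free_card ZJ eZ eD; rewrite Ic leqNgt => /negP; apply.
have B0 : (0 < B)%N by [].
apply: (@leq_ltn_trans ((D.+1 * B) ^ #|J|)).
  by case: (#|J|) => // k; rewrite leq_exp2r // mulSn addnC -addn1 leq_add2l.
rewrite expnMn; apply: (@leq_trans (B ^ #|J|.+1)); last by rewrite leq_pexp2l.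
by rewrite expnS ltn_pmul2r ?expn_gt0.
Qed.

End Cones.

(** * Coordinate subspaces *)

Section Kernels.
Variables (F : fieldType) (n : nat).
Implicit Types x : 'rV[F]_n.

Definition supported (s : nat) (sigma : 'I_s -> 'I_n) x :=
  forall j, (forall k, sigma k != j) -> x 0 j = 0.

Definition spread (s : nat) (sigma : 'I_s -> 'I_n) (v : 'rV[F]_s) : 'rV[F]_n :=
  locked (v *m rowsub sigma 1%:M).

Lemma spreadE s (sigma : 'I_s -> 'I_n) v j :
  spread sigma v 0 j = \sum_(k | sigma k == j) v 0 k.
Proof.
rewrite /spread -lock mxE [RHS]big_mkcond; apply: eq_bigr => k _.
by rewrite !mxE; case: eqP; rewrite ?mulr1 ?mulr0.
Qed.

Lemma spread_inj s (sigma : 'I_s -> 'I_n) v k :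
  injective sigma -> spread sigma v 0 (sigma k) = v 0 k.
Proof. by move=> sI; rewrite spreadE (big_pred1 k) // => i; rewrite (inj_eq sI). Qed.

Lemma supported_spread s (sigma : 'I_s -> 'I_n) v : supported sigma (spread sigma v).
Proof. by move=> j sj; rewrite spreadE big1 // => k; rewrite (negPf (sj k)). Qed.

Lemma supportedE s (sigma : 'I_s -> 'I_n) x : injective sigma ->
  supported sigma x -> x = spread sigma (colsub sigma x).
Proof.
move=> sI sx; apply/rowP => j.
have [/existsP[k /eqP<-]|] := boolP [exists k, sigma k == j].
  by rewrite spread_inj // mxE.
rewrite negb_exists => /forallP sj.
by rewrite sx // supported_spread.
Qed.

Lemma mul_spread r s (sigma : 'I_s -> 'I_n) (u : 'M[F]_(r, n)) v :
  u *m (spread sigma v)^T = colsub sigma u *m v^T.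
Proof.
by rewrite /spread -lock trmx_mul mulmxA trmx_mxsub trmx1 mulmx_colsub mulmx1.
Qed.

Lemma kernel_supported_eq0 r (sigma : 'I_r -> 'I_n) (u : 'M[F]_(r, n)) x :
  injective sigma -> \det (colsub sigma u) != 0 -> supported sigma x ->
  u *m x^T = 0 -> x = 0.
Proof.
move=> sI du sx ux; rewrite (supportedE sI sx).
have := ux; rewrite {1}(supportedE sI sx) mul_spread.
move=> /(congr1 (mulmx (invmx (colsub sigma u)))).
rewrite mulKmx ?unitmxE ?unitfE // mulmx0 => /(congr1 trmx).
by rewrite trmxK trmx0 => ->; rewrite /spread -lock mul0mx.
Qed.

Lemma kernel_supported_exists r s (sigma : 'I_s -> 'I_n) (u : 'M[F]_(r, n)) :
  injective sigma -> (\rank (colsub sigma u) < s)%N ->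
  exists x, [/\ x != 0, supported sigma x & u *m x^T = 0].
Proof.
move=> sI rk; have /rowV0Pn[v /sub_kermxP vA v0] : kermx (colsub sigma u)^T != 0.
  by rewrite kermx_eq0 /row_free mxrank_tr neq_ltn rk.
exists (spread sigma v); split; last 1 first.
- by rewrite mul_spread; apply: trmx_inj; rewrite trmx_mul trmxK vA trmx0.
- apply: contraNneq v0 => e; apply/eqP/rowP => k.
  by rewrite -(spread_inj v k sI) e !mxE.
- exact: supported_spread.
Qed.

End Kernels.

Section CoordSubspace.
Variables (K : closedFieldType) (n : nat).
Local Notation rV := 'rV[K]_n.+1.
Implicit Types (x : rV) (J : {set 'I_n.+1}).

Definition coord_subspace J : set (pspace K n) :=
  [set P : pspace K n | forall x, x \in line P -> forall j, j \notin J -> x 0 j = 0].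

Lemma cone_coord J x :
  cone (coord_subspace J) x <-> x != 0 /\ forall j, j \notin J -> x 0 j = 0.
Proof.
split=> [[x0 [P PJ xP]]|[x0 xJ]]; first by split=> //; apply: PJ.
apply/(cone_point _ x0) => y /= /vlineP[c ->] j jJ.
by rewrite mxE xJ // mulr0.
Qed.

Lemma coord_sub J J' : (J \subset J') <-> coord_subspace J `<=` coord_subspace J'.
Proof.
split=> [/fintype.subsetP JJ|/cone_sub H].
  apply/cone_sub => x /cone_coord[x0 xJ]; apply/cone_coord; split=> // j jJ.
  by apply: xJ; apply: contraNN jJ => /JJ.
apply/fintype.subsetP => j jJ; apply: contraT => jJ'.
have /H/cone_coord[_ /(_ j jJ')/eqP] : cone (coord_subspace J) (delta_mx 0 j).
  apply/cone_coord; split=> [|k kJ].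
    by apply/eqP => /rowP/(_ j); rewrite !mxE !eqxx => /eqP; rewrite oner_eq0.
  by rewrite mxE eqxx /=; case: eqP => // kj; rewrite kj jJ in kJ.
by rewrite mxE !eqxx oner_eq0.
Qed.

Lemma coord_closed J : zariski_closed (coord_subspace J).
Proof.
pose E := [set f | exists2 j, j \notin J & f = 'X_j :> {mpoly K[n.+1]}].
exists E; first by move=> _ [j _ ->]; exists 1%N; rewrite dhomogX /= mdeg1.
apply/seteqP; split=> P PJ.
  by move=> _ x [j jJ ->] xP; rewrite mevalXU; apply: PJ.
by move=> x xP j jJ; rewrite -(mevalXU (x 0) j); apply: PJ => //; exists j.
Qed.

(** For irreducibility, take an equation of each closed set and a vector of the coordinate subspace
    where it fails. On the line joining the two vectors both equations restrict to nonzero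
    polynomials, so some vector violates both. *)
Lemma coord_subvariety J : (0 < #|J|)%N -> subvariety (coord_subspace J).
Proof.
move=> /card_gt0P[j0 j0J]; split; first exact: coord_closed.
  have e0 : delta_mx 0 j0 != 0 :> rV.
    by apply/eqP => /rowP/(_ j0); rewrite !mxE !eqxx => /eqP; rewrite oner_eq0.
  exists (point e0); apply/(cone_point _ e0)/cone_coord; split=> // k kJ.
  by rewrite mxE eqxx /=; case: eqP => // kj; rewrite kj j0J in kJ.
move=> _ _ [E EH ->] [E' EH' ->] EE; apply: contrapT => /not_orP[].
rewrite !sub_zero_locus // => /existsNP[f /not_implyP[Ef /existsNP[x /not_implyP[Jx /eqP fx]]]].
move=> /existsNP[f' /not_implyP[Ef' /existsNP[x' /not_implyP[Jx' /eqP fx']]]].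
have /cone_coord[x0 xJ] := Jx; have /cone_coord[x'0 x'J] := Jx'.
have [j xj] := rV_neq0_coord x0.
pose w (k : 'I_n.+1) : {poly K} := (x 0 k)%:P + (x' 0 k - x 0 k) *: 'X.
pose y t : rV := x + t *: (x' - x).
have wE g t : (mmap polyC w g).[t] = g.@[y t 0].
  rewrite horner_mpath; apply: meval_eq => k.
  by rewrite hornerD hornerC hornerZ hornerX !mxE mulrC.
(* The third factor, a coordinate that is nonzero at [x], keeps the vector [y t] nonzero, so that it
   defines a projective point. *)
have : mmap polyC w f * mmap polyC w f' * mmap polyC w 'X_j != 0.
  rewrite !mulf_neq0 //.
  - by apply: contraNneq fx => e; rewrite -[x](addr0) -(scale0r (x' - x)) -wE e horner0.
  - by apply: contraNneq fx' => e; rewrite -[x'](subrK x) addrC -(scale1r (x' - x)) -wE e horner0.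
  apply: contraNneq xj => e; rewrite -(mevalXU (x 0) j).
  by rewrite -[x](addr0) -(scale0r (x' - x)) -wE e horner0.
move=> /horner_nonroot[t]; rewrite !hornerM !wE mevalXU !mulf_eq0 !negb_or.
case/andP=> /andP[fy fy'] yj.
have y0 : y t != 0 by apply: contraNneq yj => ->; rewrite mxE.
have /(cone_point _ y0)/EE : cone (coord_subspace J) (y t).
  by apply/cone_coord; split=> // k kJ; rewrite !mxE xJ // x'J // subrr mulr0 addr0.
have yP : y t \in line (point y0) by rewrite memv_line.
by case=> /(_ _ _ _ yP) H; [move: fy | move: fy']; rewrite H ?eqxx.
Qed.

Lemma coord_dim J p : #|J| = p.+1 -> has_dim (coord_subspace J) p.
Proof.
move=> cJ; split; last first.
  move=> /chain_length_bound bound; have := bound J; rewrite cJ ltnn.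
  by move=> H; case: (notF (H _)) => x /cone_coord[].
(* A flag of coordinate subspaces: projective dimension i takes i + 1 coordinates, hence
   [take i.+1]. *)
pose Ji (i : nat) : {set 'I_n.+1} := [set j in take i.+1 (enum J)]%SET.
have szJ : size (enum J) = p.+1 by rewrite -cardE.
have Jmem i j : (j \in Ji i) = (j \in J) && (index j (enum J) <= i)%N.
  rewrite inE; have [jJ|jJ] := boolP (j \in J); first by rewrite in_take ?mem_enum.
  by apply: contraNF jJ => /mem_take; rewrite mem_enum.
have Ji_nth i : (i <= p)%N -> exists2 j, j \in J & index j (enum J) = i.
  move=> ip; have isz : (i < size (enum J))%N by rewrite szJ.
  have [j0 _] : exists j, j \in J by apply/card_gt0P; rewrite cJ.
  exists (nth j0 (enum J) i); first by rewrite -mem_enum mem_nth.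
  by rewrite index_uniq // enum_uniq.
exists (fun i => coord_subspace (Ji i)); split.
- move=> i ip; apply: coord_subvariety; apply/card_gt0P.
  by have [j jJ ji] := Ji_nth i ip; exists j; rewrite Jmem jJ ji leqnn.
- move=> i ip; split; last first.
    move/coord_sub/fintype.subsetP => H; have [j jJ ji] := Ji_nth i.+1 ip.
    by have := H j; rewrite !Jmem jJ ji leqnn ltnn => /(_ isT).
  apply/coord_sub/fintype.subsetP => j; rewrite !Jmem => /andP[-> /=].
  exact: leqW.
- by apply/coord_sub/fintype.subsetP => j; rewrite Jmem => /andP[].
Qed.

Variables (p : nat) (J : {set 'I_n.+1}) (cJ : #|J| == p.+1).

Definition colidx (k : 'I_p.+1) : 'I_n.+1 := enum_val (cast_ord (esym (eqP cJ)) k).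

Lemma colidx_inj : injective colidx.
Proof. by move=> k l /enum_val_inj/cast_ord_inj. Qed.

Lemma colidx_mem k : colidx k \in J.
Proof. exact: enum_valP. Qed.

Lemma colidx_surj j : j \in J -> exists k, colidx k = j.
Proof.
move=> jJ; exists (cast_ord (eqP cJ) (enum_rank_in jJ j)).
by rewrite /colidx cast_ordK enum_rankK_in.
Qed.

Lemma supported_colidx x :
  supported colidx x <-> forall j, j \notin J -> x 0 j = 0.
Proof.
split=> H j Hj; apply: H.
  by move=> k; apply: contraNneq Hj => <-; apply: colidx_mem.
by apply: contraT => /negbNE/colidx_surj[k kj]; have := Hj k; rewrite kj eqxx.
Qed.

Definition coord_chow : {mpoly K[p.+1 * n.+1]} := generic_minor K id colidx.

Lemma meval_coord_chow (u : 'M[K]_(p.+1, n.+1)) :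
  coord_chow.@[mxvec u 0] = \det (colsub colidx u).
Proof. exact: mxeval_minor. Qed.

Lemma coord_section_empty (u : 'M[K]_(p.+1, n.+1)) :
  \det (colsub colidx u) != 0 -> ~ (coord_subspace J `&` linear_section u !=set0).
Proof.
move=> du [P [PJ Pu]]; have [x x0 xP] := proj_pick P; case/negP: x0.
apply/eqP; apply: (kernel_supported_eq0 colidx_inj du); last exact: Pu.
by apply/supported_colidx => j jJ; apply: PJ.
Qed.

(** On the coordinate plane the p + 1 linear forms have as matrix the columns of [u] in [J]; a
    common zero is a kernel vector of this square matrix. *)
Lemma coord_chow_form : chow_form (coord_subspace J) coord_chow.
Proof.
split; first by apply: generic_minor_irreducible => //; apply: colidx_inj.
move=> u; rewrite meval_coord_chow; split=> [/eqP du|ne]; last first.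
  by apply/eqP; apply: contraPT ne => /coord_section_empty.
have [|x [x0 /supported_colidx sx ux]] := @kernel_supported_exists _ _ _ _ _ u colidx_inj.
  rewrite ltn_neqAle rank_leq_row andbT -/(row_free _) row_free_unit unitmxE unitfE.
  by rewrite du.
exists (point x0); split.
  by apply/(cone_point _ x0)/cone_coord.
by move=> y /= /vlineP[c ->]; rewrite linearZ /= -scalemxAr ux scaler0.
Qed.

(** The genericity condition is the nonvanishing of the p x p minor on the columns of [J] other than
    the first. The kernel of [u] on the plane is then one line. *)
Lemma coord_degree : has_degree p (coord_subspace J) 1.
Proof.
have sI : injective (colidx \o lift ord0).
  by apply: inj_comp; [apply: colidx_inj | apply: lift_inj].
exists (generic_minor K id (colidx \o lift ord0)).
  exact: generic_minor_neq0.
move=> u; rewrite -/(mxeval _ u) mxeval_minor => du.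
have [|x [x0 /supported_colidx sx ux]] := @kernel_supported_exists _ _ _ _ _ u colidx_inj.
  by rewrite ltnS rank_leq_row.
rewrite (_ : _ `&` _ = [set point x0]); first exact: card_set1.
(* A kernel vector supported in [J] is determined by its coordinate at [colidx ord0], which
   therefore gives the ratio of two such vectors. *)
have zero0 (y : rV) : (forall j, j \notin J -> y 0 j = 0) -> u *m y^T = 0 ->
    y 0 (colidx ord0) = 0 -> y = 0.
  move=> yJ uy y0; apply: (kernel_supported_eq0 sI du) => // j sj.
  have [/colidx_surj[k kj]|/yJ //] := boolP (j \in J).
  have [l kl|k0] := unliftP ord0 k; last by rewrite -kj k0.
  by have := sj l; rewrite /= -kl kj eqxx.
apply/seteqP; split=> [P [PJ Pu]|_ ->]; last first.
  split; first by apply/(cone_point _ x0)/cone_coord.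
  by move=> y /= /vlineP[c ->]; rewrite linearZ /= -scalemxAr ux scaler0.
have [y y0 yP] := proj_pick P; apply: proj_eq.
rewrite /= (proj_line y0 yP); apply/eqP; rewrite eqEdim !dim_vline x0 y0 leqnn andbT.
rewrite -memvE; apply/vlineP; exists (y 0 (colidx ord0) / x 0 (colidx ord0)).
have xc : x 0 (colidx ord0) != 0 by apply: contraNneq x0 => /(zero0 _ sx ux) ->.
apply/eqP; rewrite -subr_eq0; apply/eqP; apply: zero0.
- by move=> j jJ; rewrite !mxE (sx j) // (PJ _ yP j) // mulr0 subrr.
- by rewrite linearB linearZ /= mulmxBr -scalemxAr ux scaler0 (Pu _ yP) subrr.
- by rewrite !mxE divfK // subrr.
Qed.

End CoordSubspace.

(** * Linear changes of coordinates *)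

Lemma dhomog_prod_fin n (R : comNzRingType) (mf : measure n) (I : finType)
    (F : I -> {mpoly R[n]}) (d : I -> nat) :
  (forall i, F i \is (d i).-homog for mf) -> \prod_i F i \is (\sum_i d i)%N.-homog for mf.
Proof.
move=> FH; elim/big_ind2: _ => [|f k g l fk gl|i _]; first exact: dhomog1.
  exact: dhomogM.
exact: FH.
Qed.

Section Pullback.
Variables (K : closedFieldType) (n : nat).
Local Notation rV := 'rV[K]_n.+1.
Implicit Types (x : rV) (Z : set (pspace K n)) (W V : 'M[K]_n.+1).

Lemma cone_ext Z Z' : (forall x, cone Z x <-> cone Z' x) -> Z = Z'.
Proof.
by move=> H; apply/seteqP; split; apply/cone_sub => x /H.
Qed.

(** The preimage under the projective map x |-> x W. It carries the action on linear forms over to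
    cycles. *)
Definition pullback W Z : set (pspace K n) :=
  [set P : pspace K n | forall x, x \in line P -> x != 0 -> cone Z (x *m W)].

Lemma mulmx_unit_neq0 W x : W \in unitmx -> (x *m W != 0) = (x != 0).
Proof.
move=> WU; apply/idP/idP; apply: contraNneq => e; first by rewrite e mul0mx.
by rewrite -(mulmxK WU x) e mul0mx.
Qed.

Lemma cone_pullback W Z x : W \in unitmx -> cone (pullback W Z) x <-> cone Z (x *m W).
Proof.
move=> WU; split=> [[x0 [P PZ xP]]|Zx]; first exact: PZ.
have x0 : x != 0 by case: Zx => + _; rewrite mulmx_unit_neq0.
apply/(cone_point _ x0) => y /= /vlineP[c ->]; rewrite scaler_eq0 negb_or => /andP[c0 _].
by rewrite -scalemxAl; apply: cone_scale.
Qed.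

Lemma pullbackK W Z : W \in unitmx -> pullback W (pullback (invmx W) Z) = Z.
Proof.
move=> WU; have WU' : invmx W \in unitmx by rewrite unitmx_inv.
by apply: cone_ext => x; rewrite !cone_pullback // mulmxK.
Qed.

Lemma pullbackVK W Z : W \in unitmx -> pullback (invmx W) (pullback W Z) = Z.
Proof.
by move=> WU; rewrite -{2}[W]invmxK pullbackK ?unitmx_inv.
Qed.

Lemma pullback_sub W Z Z' : W \in unitmx ->
  Z `<=` Z' -> pullback W Z `<=` pullback W Z'.
Proof.
by move=> WU /cone_sub ZZ; apply/cone_sub => x; rewrite !cone_pullback // => /ZZ.
Qed.

Lemma pullback_proper W Z Z' : W \in unitmx ->
  Z `<` Z' -> pullback W Z `<` pullback W Z'.
Proof.
move=> WU [ZZ' nZ]; split; first exact: pullback_sub.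
move=> H; apply: nZ; rewrite -(pullbackVK Z' WU) -(pullbackVK Z WU).
by apply: pullback_sub H; rewrite unitmx_inv.
Qed.

Definition lin_subst W (f : {mpoly K[n.+1]}) : {mpoly K[n.+1]} :=
  f \mPo [tuple \sum_i W i j *: 'X_i | j < n.+1].

Lemma lin_subst_eval W f x : (lin_subst W f).@[x 0] = f.@[(x *m W) 0].
Proof.
rewrite comp_mpoly_meval; apply: meval_eq => j.
rewrite tnth_mktuple mxE raddf_sum; apply: eq_bigr => i _.
by rewrite /= mevalZ mevalXU mulrC.
Qed.

Lemma lin_subst_homog W f e : f \is e.-homog -> lin_subst W f \is e.-homog.
Proof.
move=> fe; rewrite /lin_subst comp_mpolyEX big_seq; apply: rpred_sum => m ms.
apply: rpredZ; rewrite comp_mpolyX -(dhomogP _ _ _ fe m ms) /= mdegE.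
apply: dhomog_prod_fin => j; rewrite -[X in X.-homog]mul1n; apply: dhomogMn.
rewrite tnth_mktuple; apply: rpred_sum => i _; apply: rpredZ.
by rewrite dhomogX /= mdeg1.
Qed.

Lemma pullback_closed W Z : W \in unitmx -> zariski_closed Z -> zariski_closed (pullback W Z).
Proof.
move=> WU [E EH ->].
have EH' f : (lin_subst W @` E) f -> exists e : nat, f \is e.-homog.
  by move=> [g /EH[e ge] <-]; exists e; apply: lin_subst_homog.
exists (lin_subst W @` E) => //; apply: cone_ext => x.
rewrite cone_pullback // !zero_locus_cone // mulmx_unit_neq0 //.
split=> -[x0 H]; split=> // f; last by move=> Ef; rewrite -lin_subst_eval; apply: H; exists f.
by move=> [g Eg <-]; rewrite lin_subst_eval; apply: H.
Qed.

Lemma pullback_subvariety W Z : W \in unitmx -> subvariety Z -> subvariety (pullback W Z).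
Proof.
move=> WU [Zc Z0 Zirr]; split; first exact: pullback_closed.
  have [x Zx] := cone_neq0 Z0; have WV : x *m invmx W *m W = x by rewrite mulmxKV.
  have /cone_pullback : cone Z (x *m invmx W *m W) by rewrite WV.
  by move=> /(_ WU)[_ [P PZ _]]; exists P.
have WU' : invmx W \in unitmx by rewrite unitmx_inv.
move=> A B Ac Bc /(pullback_sub WU') ZAB.
have [||P ZP|H|H] := Zirr (pullback (invmx W) A) (pullback (invmx W) B).
- exact: pullback_closed.
- exact: pullback_closed.
- have [x x0 xP] := proj_pick P.
  have /ZAB : pullback (invmx W) (pullback W Z) P by rewrite pullbackVK.
  move=> /(_ x xP x0)[y0 [Q [AQ|BQ] yQ]]; [left|right].
    rewrite (_ : P = point x0); last by apply: proj_eq; rewrite (proj_line x0 xP).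
    by apply/cone_point/cone_pullback => //; split=> //; exists Q.
  rewrite (_ : P = point x0); last by apply: proj_eq; rewrite (proj_line x0 xP).
  by apply/cone_point/cone_pullback => //; split=> //; exists Q.
- by left; rewrite -(pullbackK A WU); apply: pullback_sub.
- by right; rewrite -(pullbackK B WU); apply: pullback_sub.
Qed.

Lemma pullback_chain W Z r : W \in unitmx -> has_chain Z r -> has_chain (pullback W Z) r.
Proof.
move=> WU [c [cV cc cZ]]; exists (fun i => pullback W (c i)); split.
- by move=> i ir; apply: pullback_subvariety => //; apply: cV.
- by move=> i ir; apply: pullback_proper => //; apply: cc.
- exact: pullback_sub.
Qed.

Lemma pullback_dim W Z p : W \in unitmx -> has_dim Z p -> has_dim (pullback W Z) p.
Proof.
move=> WU [ch nch]; split; first exact: pullback_chain.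
move=> H; apply: nch; rewrite -(pullbackVK Z WU).
by apply: pullback_chain H; rewrite unitmx_inv.
Qed.

Lemma pullback_card W Z : W \in unitmx -> pullback W Z #= Z.
Proof.
move=> WU; have WU' : invmx W \in unitmx by rewrite unitmx_inv.
have /boolp.choice[phi phiP] : forall P : pspace K n, exists Q : pspace K n,
    forall x, x \in line P -> x *m invmx W \in line Q.
  move=> P; have [x x0 xP] := proj_pick P.
  have y0 : x *m invmx W != 0 by rewrite mulmx_unit_neq0.
  exists (point y0) => z; rewrite (proj_line x0 xP) => /vlineP[c ->].
  by rewrite -scalemxAl memvZ //= memv_line.
have -> : pullback W Z = phi @` Z.
  apply/seteqP; split=> [P|_ [Q ZQ <-]].
    have [x x0 xP] := proj_pick P; move=> /(_ x xP x0)[y0 [Q ZQ yQ]].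
    exists Q => //; apply: proj_eq; rewrite (proj_line x0 xP).
    by apply: proj_line => //; rewrite -[x](mulmxK WU); apply: phiP.
  have [y y0 yQ] := proj_pick Q => x.
  have y1 : y *m invmx W != 0 by rewrite mulmx_unit_neq0.
  rewrite (proj_line y1 (phiP _ _ yQ)) => /vlineP[c ->].
  rewrite scaler_eq0 negb_or => /andP[c0 _].
  rewrite -scalemxAl mulmxKV //; apply: cone_scale => //.
  by split=> //; exists Q.
apply: inj_card_eq => P Q _ _ PQ; have [x x0 xP] := proj_pick P; have [y y0 yQ] := proj_pick Q.
have x1 : x *m invmx W != 0 by rewrite mulmx_unit_neq0.
have := phiP _ _ yQ; rewrite -PQ (proj_line x1 (phiP _ _ xP)) => /vlineP[c].
move=> /(congr1 (mulmx^~ W)); rewrite -scalemxAl !mulmxKV // => yx.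
apply: proj_eq; rewrite [RHS](proj_line y0 yQ); apply: proj_line => //.
by rewrite yx memvZ.
Qed.

Section MatrixSubst.
Variable a : nat.
Local Notation PR := {mpoly K[a * n.+1]}.

(** The substitution of u V for u. [V] may be singular: a projector is substituted when plane forms
    are separated. *)
Definition mxsubst V (f : PR) : PR :=
  f \mPo [tuple mxvec (generic_mx a n.+1 K *m map_mx (@mpolyC _ K) V) 0 k | k < a * n.+1].

HB.instance Definition _ V := GRing.RMorphism.copy (mxsubst V)
  (comp_mpoly [tuple mxvec (generic_mx a n.+1 K *m map_mx (@mpolyC _ K) V) 0 k | k < a * n.+1]).

Lemma mxsubst_eval V f u : mxeval (mxsubst V f) u = mxeval f (u *m V).
Proof.
rewrite /mxeval comp_mpoly_meval; apply: meval_eq => k; rewrite tnth_mktuple.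
have <- : map_mx (meval (mxvec u 0)) (generic_mx a n.+1 K *m map_mx (@mpolyC _ K) V) = u *m V.
  rewrite map_mxM generic_mx_eval; congr (_ *m _).
  by apply/matrixP => i j; rewrite !mxE /= mevalC.
by rewrite -map_mxvec !mxE.
Qed.

Lemma mxsubstZ V c f : mxsubst V (c *: f) = c *: mxsubst V f.
Proof. exact: comp_mpolyZ. Qed.

Lemma mxsubstK V : V \in unitmx -> cancel (mxsubst V) (mxsubst (invmx V)).
Proof.
by move=> VU f; apply: mxeval_inj => u; rewrite !mxsubst_eval mulmxKV.
Qed.

Lemma mxsubst_irreducible V f : V \in unitmx ->
  irreducible_mpoly f -> irreducible_mpoly (mxsubst V f).
Proof.
move=> VU [fN fI]; split.
  by apply: contraNN fN => /(rmorph_unit (mxsubst (invmx V))) /=; rewrite mxsubstK.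
move=> g h fgh; have VU' : invmx V \in unitmx by rewrite unitmx_inv.
have := fI (mxsubst (invmx V) g) (mxsubst (invmx V) h).
rewrite -rmorphM -fgh /= mxsubstK // => /(_ erefl).
have K' k : mxsubst V (mxsubst (invmx V) k) = k.
  by have := mxsubstK VU' k; rewrite invmxK.
by case=> /(rmorph_unit (mxsubst V)) /=; rewrite K'; [left|right].
Qed.

End MatrixSubst.

(* x lies on the pullback by (V^-1)^T and on the section by u iff its image
   lies on Z and on the section by u V. *)
Lemma pullback_section r V Z (u : 'M[K]_(r, n.+1)) : V \in unitmx ->
  pullback (invmx V)^T Z `&` linear_section u =
  pullback (invmx V)^T (Z `&` linear_section (u *m V)).
Proof.
move=> VU; have WU : (invmx V)^T \in unitmx by rewrite unitmx_tr unitmx_inv.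
have uV x : u *m V *m (x *m (invmx V)^T)^T = u *m x^T.
  by rewrite trmx_mul trmxK -mulmxA mulKVmx.
apply/seteqP; split=> P.
  move=> [PZ Pu] x xP x0; have [y0 [Q ZQ yQ]] := PZ x xP x0; split=> //.
  exists Q => //; split=> // z; rewrite (proj_line y0 yQ) => /vlineP[c ->].
  by rewrite linearZ /= -scalemxAr uV Pu // scaler0.
move=> H; split=> x xP; first by move=> x0; have [y0 [Q [ZQ _] yQ]] := H x xP x0; split=> //; exists Q.
have [->|x0] := eqVneq x 0; first by rewrite trmx0 mulmx0.
have [y0 [Q [_ Qu] yQ]] := H x xP x0.
by rewrite -uV; apply: Qu.
Qed.

Lemma pullback_neq0 W Z : W \in unitmx -> pullback W Z !=set0 <-> Z !=set0.
Proof.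
move=> WU; split.
  by move=> /cone_neq0[x]; rewrite cone_pullback // => -[_ [P ZP _]]; exists P.
move=> /cone_neq0[x Zx]; have : cone (pullback W Z) (x *m invmx W).
  by rewrite cone_pullback // mulmxKV.
by move=> [_ [P PZ _]]; exists P.
Qed.

Lemma pullback_chow_form p V Z (f : {mpoly K[p.+1 * n.+1]}) : V \in unitmx ->
  chow_form Z f -> chow_form (pullback (invmx V)^T Z) (mxsubst V f).
Proof.
move=> VU [fI fZ]; have WU : (invmx V)^T \in unitmx by rewrite unitmx_tr unitmx_inv.
split=> [|u]; first exact: mxsubst_irreducible.
by rewrite -/(mxeval _ u) mxsubst_eval fZ pullback_section // pullback_neq0.
Qed.

Lemma pullback_degree p V Z e : V \in unitmx ->
  has_degree p Z e -> has_degree p (pullback (invmx V)^T Z) e.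
Proof.
move=> VU [G G0 GZ]; have WU : (invmx V)^T \in unitmx by rewrite unitmx_tr unitmx_inv.
exists (mxsubst V G).
  by apply: contraNneq G0 => e0; rewrite -(mxsubstK VU G) e0 rmorph0.
move=> u; rewrite -/(mxeval _ u) mxsubst_eval => /GZ Zu.
rewrite pullback_section //; apply: card_eq_trans Zu; exact: pullback_card.
Qed.

End Pullback.

Section ChowForms.
Variables (K : closedFieldType) (n p d : nat).
Local Notation PR := {mpoly K[p.+1 * n.+1]}.

(** The scalar [c] is there because a point of the Chow variety is a line of forms, while Chow forms
    of components are fixed only up to scalars. *)
Definition is_chow_form (f : PR) : Prop :=
  exists C : effective_cycle K n p, cycle_has_degree C d /\
    exists2 c, c != 0 & cycle_chow_form C (c *: f).

Lemma is_chow_formZ (f : PR) c : c != 0 -> is_chow_form f -> is_chow_form (c *: f).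
Proof.
move=> c0 [C [Cd [e e0 Cf]]]; exists C; split=> //; exists (e / c).
  by rewrite mulf_neq0 ?invr_eq0.
by rewrite scalerA divfK.
Qed.

Lemma is_chow_form_subst V (f : PR) : V \in unitmx ->
  is_chow_form f -> is_chow_form (mxsubst V f).
Proof.
move=> VU [C [[e eC ed] [c c0 [g gC fg]]]].
have WU : (invmx V)^T \in unitmx by rewrite unitmx_tr unitmx_inv.
pose C' := EffectiveCycle (@multiplicity _ _ _ C)
  (fun i => pullback_subvariety WU (component_subvariety i))
  (fun i => pullback_dim WU (component_dim i)).
exists C'; split.
  by exists e => // i; apply: pullback_degree.
exists c => //; exists (fun i => mxsubst V (g i)).
  by move=> i; apply: pullback_chow_form.
rewrite -mxsubstZ fg rmorph_prod; apply: eq_bigr => i _.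
by rewrite rmorphXn.
Qed.

End ChowForms.

(** * Chow forms fixed by the torus *)

Section Extension.
Variable T : finType.

Lemma superset_card (S : {set T}) k : (#|S| <= k)%N -> (k <= #|T|)%N ->
  exists2 J : {set T}, S \subset J & #|J| = k.
Proof.
move=> Sk kT; pose s := (enum S ++ enum (~: S))%SET.
have s_uniq : uniq s.
  rewrite cat_uniq !enum_uniq /= andbT; apply/hasPn => x.
  by rewrite !mem_enum inE.
have s_all x : x \in s by rewrite mem_cat !mem_enum inE orbN.
have s_size : size s = #|T|.
  by rewrite -(card_uniqP s_uniq); apply: eq_card => x; rewrite s_all.
exists [set x in take k s]%SET.
  apply/fintype.subsetP => x xS; rewrite inE in_take // index_cat mem_enum xS.
  by apply: leq_trans Sk; rewrite cardE index_mem mem_enum.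
rewrite cardsE (card_uniqP _) ?take_uniq // size_takel // s_size //.
Qed.

End Extension.

Definition coord_sets n p := {J : {set 'I_n.+1} | #|J| == p.+1}.

Definition plane_form (R : comNzRingType) n p (J : coord_sets n p) :
    {mpoly R[p.+1 * n.+1]} :=
  generic_minor R id (colidx (svalP J)).

Section ToricComponents.
Variables (K : closedFieldType) (n p : nat).
Local Notation rV := 'rV[K]_n.+1.
Local Notation PR := {mpoly K[p.+1 * n.+1]}.
Implicit Types (u : 'M[K]_(p.+1, n.+1)) (x : rV) (Z : set (pspace K n)) (g : PR).

Definition supp x : {set 'I_n.+1} := [set j | x 0 j != 0]%SET.

Definition torus_stable g :=
  forall u (t : rV), (forall j, t 0 j != 0) -> mxeval g (u *m diag_mx t) = 0 -> mxeval g u = 0.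

Lemma col_homog_torus_stable g : col_homog g -> torus_stable g.
Proof.
move=> /col_homog_eval[e gE] u t t0; rewrite /mxeval gE => /eqP.
rewrite mulf_eq0 => /orP[|/eqP //]; rewrite prodf_seq_eq0 => /hasP[j _ /=].
by rewrite expf_eq0 (negPf (t0 j)) andbF.
Qed.

(* Fix tau : 'I_p.+1 -> supp x and let R be the rest of the support. A vector y
   with support supp x and y_R = 1 is in the kernel of u as soon as
   y_tau = - U^-1 u 1_R, where U is formed by the columns of u in tau; it has the
   required support outside of the zeros of det U * \prod_k (\adj U u 1_R)_k. *)
Lemma torus_stable_supp Z g x : g != 0 -> torus_stable g ->
  (forall u, Z `&` linear_section u !=set0 -> mxeval g u = 0) ->
  cone Z x -> (#|supp x| <= p.+1)%N.
Proof.
move=> g0 gT gZ Zx; rewrite leqNgt; apply/negP => xp.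
have x0 := Zx.1.
pose j0 : 'I_n.+1 := nth ord0 (enum (supp x)) p.+1.
pose tau (k : 'I_p.+1) : 'I_n.+1 := nth ord0 (enum (supp x)) k.
have sz : (p.+1 < size (enum (supp x)))%N by rewrite -cardE.
have szk (k : 'I_p.+1) : (k < size (enum (supp x)))%N by apply: ltn_trans (ltn_ord k) sz.
have tauI : injective tau.
  by move=> k l /eqP; rewrite nth_uniq ?enum_uniq // => /eqP/val_inj.
have tau_supp k : tau k \in supp x by rewrite -mem_enum mem_nth.
have j0_supp : j0 \in supp x by rewrite -mem_enum mem_nth.
have tau_j0 k : tau k != j0.
  by rewrite nth_uniq ?enum_uniq // neq_ltn ltn_ord.
pose R : {set 'I_n.+1} := [set j in supp x | [forall k, tau k != j]]%SET.
have j0R : j0 \in R by rewrite inE j0_supp; apply/forallP => k; apply: tau_j0.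
have tauR k : tau k \in R = false.
  by rewrite inE tau_supp /=; apply/forallP => /(_ k); rewrite eqxx.
pose rest : rV := \row_j (j \in R)%:R.
pose U u := colsub tau u; pose v u := u *m rest^T.
pose gU := colsub tau (generic_mx p.+1 n.+1 K).
pose gv := generic_mx p.+1 n.+1 K *m map_mx (@mpolyC _ K) rest^T.
pose H := \det gU * \prod_k (\adj gU *m gv) k 0.
have HE u : mxeval H u = \det (U u) * \prod_k (\adj (U u) *m v u) k 0.
  have gUE : map_mx (meval (mxvec u 0)) gU = U u by rewrite map_mxsub generic_mx_eval.
  have gvE : map_mx (meval (mxvec u 0)) gv = v u.
    rewrite map_mxM generic_mx_eval; congr (_ *m _).
    by apply/matrixP => i j; rewrite !mxE /= mevalC.
  rewrite mxevalM -gUE det_map_mx; congr (_ * _).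
  rewrite /mxeval rmorph_prod; apply: eq_bigr => k _.
  by rewrite -map_mx_adj -gvE -map_mxM [RHS]mxE.
have H0 : H != 0.
  (* At this matrix [H] is 1: the columns in [tau] form the identity, the column [j0] consists of
     ones, and the other columns of [R] are zero. *)
  pose w : 'M[K]_(p.+1, n.+1) := \matrix_(i, j) (if j == j0 then 1 else (tau i == j)%:R).
  have Uw : U w = 1%:M.
    by apply/matrixP => i k; rewrite !mxE (negPf (tau_j0 k)) (inj_eq tauI).
  have vw k : v w k 0 = 1.
    rewrite mxE (bigD1 j0) //= big1 => [|j jj0]; rewrite !mxE.
      by rewrite eqxx mul1r addr0 j0R.
    by rewrite (negPf jj0); case: eqP => [<-|_]; rewrite ?mul0r // tauR mulr0.
  apply/eqP => /(congr1 (fun f => mxeval f w)); rewrite HE Uw det1 mul1r adj1.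
  rewrite big1; last by move=> k _; rewrite mul1mx.
  by rewrite /mxeval meval0 => /eqP; rewrite oner_eq0.
have gH : g * H = 0.
  apply: mxeval_eq0 => u; rewrite mxevalM.
  have [->|] := eqVneq (mxeval H u) 0; first by rewrite mulr0.
  rewrite HE mulf_eq0 negb_or => /andP[dU adjU].
  have UU : U u \in unitmx by rewrite unitmxE unitfE.
  pose z := invmx (U u) *m v u.
  have z0 k : z k 0 != 0.
    rewrite /z /invmx UU -scalemxAl mxE mulf_neq0 ?invr_eq0 //.
    by apply: contraNneq adjU => e; rewrite (bigD1 k) //= e mul0r.
  pose y := rest - spread tau z^T.
  have yE j : y 0 j = (j \in R)%:R - spread tau z^T 0 j.
    by rewrite [LHS]mxE [X in X + _]mxE [X in _ + X]mxE.
  have uy : u *m y^T = 0.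
    by rewrite linearB /= mulmxBr mul_spread trmxK -/(U u) mulKVmx // subrr.
  have ytau k : y 0 (tau k) = - z k 0.
    by rewrite yE spread_inj // mxE tauR sub0r.
  have yR j : j \in R -> y 0 j = 1.
    move=> jR; rewrite yE jR supported_spread ?subr0 // => k.
    by move: jR; rewrite inE => /andP[_ /forallP].
  have yN j : j \notin supp x -> y 0 j = 0.
    move=> jx; rewrite yE inE (negPf jx) sub0r supported_spread ?oppr0 // => k.
    by apply: contraNneq jx => <-.
  have yS j : j \in supp x -> y 0 j != 0.
    move=> jx; have [jR|] := boolP (j \in R); first by rewrite yR ?oner_eq0.
    rewrite inE jx negb_forall => /existsP[k]; rewrite negbK => /eqP <-.
    by rewrite ytau oppr_eq0.
  (* The torus element moving [x] to [y]; the value 1 off the support keeps it invertible. Thus [x]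
     lies on the section by [u *m diag_mx t], where [g] vanishes, and stability brings the zero back
     to [u]. *)
  pose t : rV := \row_j (if j \in supp x then y 0 j / x 0 j else 1).
  have t0 j : t 0 j != 0.
    rewrite mxE; case: ifP => [jx|_]; last exact: oner_neq0.
    by rewrite mulf_neq0 ?invr_eq0 ?yS //; move: jx; rewrite inE.
  have tx : diag_mx t *m x^T = y^T.
    apply/colP => j; rewrite mul_diag_mx [LHS]mxE [RHS]mxE ![in LHS]mxE; case: ifP => jx.
      by rewrite divfK //; move: jx; rewrite inE.
    have := jx; rewrite inE => /negbFE/eqP->; rewrite mulr0.
    by rewrite yN // jx.
  have -> : mxeval g u = 0; last by rewrite mul0r.
  apply: (gT u t t0); apply: gZ; exists (point x0); split; first exact/cone_point.
  by move=> _ /vlineP[c ->]; rewrite linearZ -scalemxAr -mulmxA tx uy scaler0.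
by have := mulf_neq0 g0 H0; rewrite gH eqxx.
Qed.

(** By primality the product of all coordinates that do not vanish identically on [Z] does not
    vanish on [Z] either; [x] is a vector where it is nonzero. *)
Lemma subvariety_sub_coord Z : subvariety Z ->
  exists2 x, cone Z x & Z `<=` coord_subspace (supp x).
Proof.
move=> ZV; pose S : {set 'I_n.+1} := [set j | `[< ~ vanish ('X_j : {mpoly K[n.+1]}) Z >]]%SET.
have [x Zx xS] : exists2 x, cone Z x & forall j, j \in S -> x 0 j != 0.
  have : ~ vanish (\prod_(j in S) ('X_j : {mpoly K[n.+1]})) Z.
    have h1 (j : 'I_n.+1) : ('X_j : {mpoly K[n.+1]}) \is 1.-homog by rewrite dhomogX /= mdeg1.
    suff [] : \prod_(j in S) ('X_j : {mpoly K[n.+1]}) \is (\sum_(j in S) 1)%N.-homog /\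
              ~ vanish (\prod_(j in S) ('X_j : {mpoly K[n.+1]})) Z by [].
    elim/big_rec2: _ => [|j k f jS [fk fZ]].
      split; first exact: dhomog1.
      have [_ /cone_neq0[x Zx] _] := ZV => /(_ x Zx)/eqP.
      by rewrite meval1 oner_eq0.
    split; first exact: dhomogM.
    move=> /(subvariety_prime ZV (h1 j) fk)[] //.
    by move: jS; rewrite inE => /asboolP.
  move=> /existsNP[x /not_implyP[Zx /eqP]]; rewrite rmorph_prod /=.
  under eq_bigr do rewrite mevalXU; move=> /prodf_neq0 H.
  by exists x.
exists x => //; apply/cone_sub => y Zy; apply/cone_coord; split; first exact: Zy.1.
move=> j; rewrite inE => /negbNE/eqP xj.
have : j \notin S by apply/negP => /xS; rewrite xj eqxx.
by rewrite inE => /asboolPn/contrapT/(_ y Zy); rewrite mevalXU.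
Qed.


Lemma torus_stable_chow_form Z g : subvariety Z -> has_dim Z p -> chow_form Z g ->
  torus_stable g -> exists (J : coord_sets n p) c, c != 0 /\ g = c *: plane_form K J.
Proof.
move=> ZV [Zch _] [gI gZ] gT.
have g0 := irreducible_mpoly_neq0 gI.
(* A chain of length [p] needs more than [p] coordinates; this leaves room to enlarge the support of
   [x] to p + 1 elements. *)
have pn : (p.+1 <= n.+1)%N.
  have := @chain_length_bound _ _ _ _ [set: 'I_n.+1]%SET Zch.
  by rewrite cardsT card_ord; apply => x _ j; rewrite inE.
have [x Zx ZS] := subvariety_sub_coord ZV.
have xp : (#|supp x| <= p.+1)%N.
  by apply: torus_stable_supp gT _ Zx => // u /gZ.
have [|J SJ /eqP cJ] := superset_card xp; first by rewrite card_ord.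
exists (exist _ J cJ).
have [|c c0 gE] := irreducible_eq_minor (@inj_id _) (@colidx_inj _ _ _ cJ) gI; last first.
  exists c; split; first exact: c0.
  rewrite gE; congr (_ *: _); rewrite /plane_form.
  by congr (generic_minor _ _ (colidx _)); apply: bool_irrelevance.
(* Where the minor is nonzero, the section misses the coordinate plane, hence also [Z], so the Chow
   form does not vanish. *)
move=> u du; apply/eqP => /gZ[P [ZP Pu]]; apply: (coord_section_empty du).
exists P; split=> //; move/coord_sub: SJ => SJ; exact/SJ/ZS.
Qed.

End ToricComponents.

Section MinorHomog.
Variables (R : comNzRingType) (a b r : nat) (rho : 'I_r -> 'I_a) (sigma : 'I_r -> 'I_b).

(** Each term of the Leibniz expansion takes one entry from every selected column, and the weight of
    an entry depends on its column only. This covers both the total degree and the column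
    degrees. *)
Lemma generic_minor_homog (mf : measure (a * b)) (w : 'I_r -> nat) :
  (forall i k, mf U_(mxvec_index (rho i) (sigma k))%MM = w k) ->
  generic_minor R rho sigma \is (\sum_k w k)%N.-homog for mf.
Proof.
move=> mfw; rewrite generic_minorE; apply: rpred_sum => s _.
have h : \prod_i (mxsub rho sigma (generic_mx a b R)) i (s i)
    \is (\sum_k w k)%N.-homog for mf.
  have -> : (\sum_k w k = \sum_i w (s i))%N by rewrite [LHS](reindex_inj (@perm_inj _ s)).
  apply: dhomog_prod_fin => i.
  by rewrite !mxE dhomogX mfw.
by case: (s : bool); rewrite ?expr1 ?expr0 ?mulN1r ?mul1r ?rpredN.
Qed.

Lemma map_generic_minor (S : comNzRingType) (h : {rmorphism R -> S}) :
  map_mpoly h (generic_minor R rho sigma) = generic_minor S rho sigma.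
Proof.
rewrite !generic_minorE -det_map_mx; congr (\det _).
by apply/matrixP => i j; rewrite !mxE /= map_mpolyX.
Qed.

Lemma colwU (j l : 'I_b) (i : 'I_a) : colw j U_(mxvec_index i l)%MM = (l == j).
Proof.
rewrite /colw (bigD1 i) //= mnm1E mxvec_index_eq eqxx big1 ?addn0 // => k ki.
by rewrite mnm1E mxvec_index_eq eq_sym (negPf ki).
Qed.

End MinorHomog.

Section PlaneMonomial.
Variables (R : idomainType) (n p : nat).
Local Notation Js := (coord_sets n p).
Local Notation PR := {mpoly R[p.+1 * n.+1]}.

Definition plane_mono (m : Js -> nat) : PR := \prod_J plane_form R J ^+ m J.

Lemma plane_form_homog (J : Js) : plane_form R J \is p.+1.-homog.
Proof.
rewrite -[X in X.-homog](card_ord p.+1) -sum1_card.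
by apply: (generic_minor_homog _ (mf := mdeg)) => i k; rewrite /= mdeg1.
Qed.

Lemma plane_mono_homog m : plane_mono m \is (p.+1 * \sum_J m J)%N.-homog.
Proof.
rewrite big_distrr /=; apply: dhomog_prod_fin => J; apply: dhomogMn.
exact: plane_form_homog.
Qed.

Lemma plane_mono_col_homog m : col_homog (plane_mono m).
Proof.
move=> j; exists (\sum_(J : Js) (\sum_k (colidx (svalP J) k == j)) * m J)%N.
apply: dhomog_prod_fin => J; apply: dhomogMn; apply: generic_minor_homog => i k.
by rewrite /= colwU.
Qed.

End PlaneMonomial.

Section ToricChowForms.
Variables (K : closedFieldType) (n p : nat).
Local Notation Js := (coord_sets n p).
Local Notation PR := {mpoly K[p.+1 * n.+1]}.
Implicit Types (m : Js -> nat) (f : PR) (u : 'M[K]_(p.+1, n.+1)).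

Lemma plane_form_eval (J : Js) u :
  mxeval (plane_form K J) u = \det (colsub (colidx (svalP J)) u).
Proof. exact: mxeval_minor. Qed.

Lemma plane_form_neq0 (J : Js) : plane_form K J != 0.
Proof. by apply: generic_minor_neq0 => //; apply: colidx_inj. Qed.

Lemma plane_mono_neq0 m : plane_mono K m != 0.
Proof. by apply/prodf_neq0 => J _; rewrite expf_neq0 // plane_form_neq0. Qed.

Lemma plane_mono_chow_form m d : (\sum_J m J)%N = d -> is_chow_form d (plane_mono K m).
Proof.
move=> md; have subv (i : 'I_#|{: Js}|) :
    subvariety (coord_subspace (val (enum_val i)) : set (pspace K n)).
  by apply: coord_subvariety; rewrite (eqP (svalP (enum_val i))).
have dimp (i : 'I_#|{: Js}|) :
    has_dim (coord_subspace (val (enum_val i)) : set (pspace K n)) p.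
  by apply: coord_dim; rewrite (eqP (svalP (enum_val i))).
pose C := EffectiveCycle (fun i => m (enum_val i)) subv dimp.
exists C; split.
  exists (fun=> 1%N); first by move=> i; apply: coord_degree (svalP (enum_val i)).
  rewrite -md [RHS](reindex _ (onW_bij _ (enum_val_bij Js))) /=.
  by apply: eq_bigr => i _; rewrite muln1.
exists 1; rewrite ?oner_neq0 // scale1r.
exists (fun i => plane_form K (enum_val i)).
  by move=> i; apply: coord_chow_form.
by rewrite /plane_mono [LHS](reindex _ (onW_bij _ (enum_val_bij Js))).
Qed.

Lemma toric_chow_form d f : f \is (p.+1 * d)%N.-homog -> col_homog f -> is_chow_form d f ->
  exists m c, [/\ (\sum_J m J)%N = d, c != 0 & f = c *: plane_mono K m].
Proof.
move=> fd fc [C [_ [e e0 [g gC fg]]]].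
have g0 i : g i != 0 by apply: irreducible_mpoly_neq0; have [] := gC i.
have ef0 : e *: f != 0 by rewrite fg; apply/prodf_neq0 => i _; rewrite expf_neq0.
have efc : col_homog (e *: f) by move=> j; have [a fa] := fc j; exists a; apply: dhomogZ.
pose good h := exists m c, c != 0 /\ h = c *: plane_mono K m.
have goodM h k : good h -> good k -> good (h * k).
  move=> [m [c [c0 ->]]] [m' [c' [c'0 ->]]]; exists (fun J => m J + m' J)%N, (c * c').
  split; first by rewrite mulf_neq0.
  rewrite -scalerAl -scalerAr scalerA; congr (_ *: _).
  by rewrite /plane_mono -big_split; apply: eq_bigr => J _; rewrite exprD.
have good1 : good 1.
  exists (fun=> 0%N), 1; split; first exact: oner_neq0.
  by rewrite scale1r /plane_mono big1.
have [m [c [c0 efm]]] : good (e *: f).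
  rewrite fg; elim/big_ind: _ => // i _.
  (* A component of multiplicity 0 contributes the factor 1. Its Chow form need not divide [f], so
     nothing is known about its column degrees. *)
  have [->|mi0] := eqVneq (multiplicity i) 0%N; first by rewrite expr0.
  suff gi : good (g i).
    by elim: (multiplicity i) => [|k IH]; rewrite ?expr0 // exprS; apply: goodM.
  have gic : col_homog (g i).
    have E : e *: f = g i *
        (g i ^+ (multiplicity i).-1 * \prod_(k | k != i) g k ^+ multiplicity k).
      by rewrite fg (bigD1 i) //= mulrA -exprS prednK // lt0n.
    by move: ef0 efc; rewrite E; apply: col_homog_factor.
  have [J [c [c0 ->]]] := torus_stable_chow_form (component_subvariety i)
     (component_dim i) (gC i) (col_homog_torus_stable gic).
  exists (fun J' => (J' == J) : nat), c; split=> //; congr (_ *: _).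
  rewrite /plane_mono (bigD1 J) //= eqxx expr1 big1 ?mulr1 // => J' /negPf ->.
  by rewrite expr0.
exists m, (e^-1 * c); rewrite -scalerA -efm scalerA mulVf // scale1r.
split=> //; last by rewrite mulf_neq0 ?invr_eq0.
(* The number of minors, counted with multiplicity, comes from comparing total degrees, each minor
   having degree p + 1. *)
apply/eqP; rewrite -(eqn_pmul2l (ltn0Sn p)); apply/eqP.
apply: (dhomog_uniq (plane_mono_neq0 m)); first exact: plane_mono_homog.
have -> : plane_mono K m = (c^-1 * e) *: f by rewrite -scalerA efm scalerA mulVf // scale1r.
exact: dhomogZ.
Qed.

(* x is the indicator of J and u |-> u r projects onto the matrices killing x;
   for J' != J some matrix killing x has a nonzero minor at J'. *)
Lemma plane_form_separate (J : Js) : exists u,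
  mxeval (plane_form K J) u = 0 /\
  forall J', J' != J -> mxeval (plane_form K J') u != 0.
Proof.
pose x : 'rV[K]_n.+1 := \row_j (j \in val J)%:R.
have [j0 j0J] : exists j, j \in val J by apply/card_gt0P; rewrite (eqP (svalP J)).
have xj0 : x 0 j0 = 1 by rewrite mxE j0J.
pose e0 : 'rV[K]_n.+1 := delta_mx 0 j0.
pose r : 'M[K]_n.+1 := 1%:M - x^T *m e0.
have e0x : e0 *m x^T = 1%:M by apply/matrixP => i j; rewrite !ord1 -rowE !mxE j0J.
have rx u : u *m r *m x^T = 0.
  by rewrite mulmxBr mulmx1 mulmxBl -!mulmxA e0x mulmx1 subrr.
have rid u : u *m x^T = 0 -> u *m r = u.
  by move=> ux; rewrite mulmxBr mulmx1 mulmxA ux mul0mx subr0.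
have sep J' : J' != J -> mxsubst r (plane_form K J') != 0.
  move=> JJ'.
  have [j jJ jJ'] : exists2 j, j \in val J & j \notin val J'.
    apply/subsetPn; apply: contraNN JJ' => JJ'; rewrite -val_eqE eq_sym.
    by rewrite eqEcard JJ' (eqP (svalP J)) (eqP (svalP J')) /=.
  pose s := colidx (svalP J').
  have sJ' k : s k \in val J' by apply: colidx_mem.
  (* The columns in [J'] form the identity, and column [j], in [J] but not in [J'], is chosen so
     that every row sums to zero over [J]. *)
  pose u : 'M[K]_(p.+1, n.+1) := \matrix_(i, l)
    (if l == j then - (s i \in val J)%:R else (s i == l)%:R).
  have us : colsub s u = 1%:M.
    apply/matrixP => i k; rewrite !mxE (inj_eq (@colidx_inj _ _ _ _)).
    by case: eqP => // sj; rewrite -sj sJ' in jJ'.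
  have ux : u *m x^T = 0.
    apply/colP => i; rewrite !mxE (bigD1 j) //= !mxE eqxx jJ mulr1.
    have [siJ|siJ] := boolP (s i \in val J); last first.
      rewrite oppr0 add0r big1 // => l lj; rewrite !mxE (negPf lj).
      by case: eqP => [<-|]; rewrite ?(negPf siJ) ?mulr0 ?mul0r.
    have sij : s i != j by apply: contraNneq jJ' => <-.
    rewrite (bigD1 (s i)) //= !mxE (negPf sij) eqxx siJ mulr1 big1 ?addr0 ?addNr //.
    by move=> l /andP[lj ls]; rewrite !mxE (negPf lj) eq_sym (negPf ls) mul0r.
  apply/eqP => /(congr1 (fun h => mxeval h u)).
  rewrite mxsubst_eval rid // plane_form_eval us det1 /mxeval meval0 => /eqP.
  by rewrite oner_eq0.
(* The product being nonzero, a single matrix serves all [J'] at once. *)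
have : \prod_(J' | J' != J) mxsubst r (plane_form K J') != 0 by apply/prodf_neq0.
move=> /mxeval_nonroot[u uN]; exists (u *m r); split; last first.
  move=> J' J'J; rewrite -mxsubst_eval.
  by move: uN; rewrite /mxeval rmorph_prod => /prodf_neq0/(_ _ J'J).
rewrite plane_form_eval; apply/eqP; apply: contraT => du.
have : x = 0; last by move=> /rowP/(_ j0); rewrite xj0 mxE => /eqP; rewrite oner_eq0.
apply: (kernel_supported_eq0 (@colidx_inj _ _ _ _) du) (rx u).
by apply/supported_colidx => j /negPf jJ; rewrite mxE jJ.
Qed.

(** If an exponent at J were larger on one side, cancel the smaller power of that minor and evaluate
    at the separating matrix: one side is zero, the other is not. *)
Lemma plane_mono_inj m m' c : c != 0 -> plane_mono K m = c *: plane_mono K m' -> m =1 m'.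
Proof.
have le (a a' : Js -> nat) e :
    e != 0 -> plane_mono K a = e *: plane_mono K a' -> forall J, (a' J <= a J)%N.
  move=> e0 aa' J; rewrite leqNgt; apply/negP => lt.
  have [u [uJ uJ']] := plane_form_separate J.
  have /mulfI canc : plane_form K J ^+ a J != 0 by rewrite expf_neq0 // plane_form_neq0.
  have E : \prod_(J' | J' != J) plane_form K J' ^+ a J' =
      e *: (plane_form K J ^+ (a' J - a J) * \prod_(J' | J' != J) plane_form K J' ^+ a' J').
    apply: canc; rewrite -scalerAr mulrA -exprD subnKC; last exact: ltnW.
    by move: aa'; rewrite /plane_mono (bigD1 J) //= [in RHS](bigD1 J).
  have := congr1 (fun h => mxeval h u) E.
  rewrite mxevalZ mxevalM mxevalX uJ expr0n subn_eq0 leqNgt lt mul0r mulr0.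
  apply/eqP; rewrite /mxeval rmorph_prod; apply/prodf_neq0 => J' /uJ'.
  by rewrite rmorphXn /= => h; rewrite expf_neq0.
move=> c0 mm' J; apply/eqP; rewrite eqn_leq (le _ _ _ c0 mm') andbT.
apply: (le _ _ c^-1); first by rewrite invr_eq0.
by rewrite mm' scalerA mulVf // scale1r.
Qed.

End ToricChowForms.

(** * Counting modulo q - 1 *)

(** The order of [x] divides every [e i], so [k] times the order divides the gcd [k]. This gives
    freeness once the gcd has been divided out. *)
Lemma expr_unit_eq1 (L : finFieldType) (I : finType) (P : pred I) (e : I -> nat) k
    (x : {unit L}) : (0 < k)%N ->
  (\big[gcdn/0%N]_(i | P i) (k * e i) = k)%N ->
  (forall i, P i -> (x ^+ e i = 1)%g) -> x = 1%g.
Proof.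
move=> k0 kE xe; apply/eqP; rewrite -order_eq1 -dvdn1 -(dvdn_pmul2l k0) muln1.
rewrite -[X in (_ %| X)%N]kE; apply/dvdn_biggcdP => i Pi.
by rewrite dvdn_pmul2l // order_dvdn xe.
Qed.

Section FreeScaling.
Variables (L : finFieldType) (M : finType).
Local Notation A := {ffun M -> L}.
Implicit Types (c : A) (S : {set A}) (s : {unit L}).

Definition fsupp c : {set M} := [set m | c m != 0]%SET.

Definition scale_by (e : M -> nat) c s : A := [ffun m => c m * val s ^+ e m].

Lemma scale_by_is_action e : is_action [set: {unit L}]%SET (scale_by e).
Proof.
have s1 : (scale_by e)^~ 1%g =1 id.
  by move=> c; apply/ffunP => m; rewrite ffunE expr1n mulr1.
have sM c : act_morph (scale_by e) c.
  by move=> s t; apply/ffunP => m; rewrite !ffunE /= exprMn mulrA.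
by have [] := is_total_action s1 sM.
Qed.

Definition scale_action e := Action (scale_by_is_action e).

Lemma fsupp_scale e c s : fsupp (scale_by e c s) = fsupp c.
Proof.
apply/setP => m; rewrite !inE ffunE mulf_eq0 expf_eq0.
have -> : (val s == 0) = false by apply/negbTE; rewrite -unitfE; apply: valP.
by rewrite andbF orbF.
Qed.

Lemma free_scaling_card S e :
  (forall c s, c \in S -> scale_by e c s \in S) ->
  (forall c s, c \in S -> scale_by e c s = c -> s = 1%g) ->
  (#|L|.-1 %| #|S|)%N.
Proof.
move=> Sact Sfree; pose G := [set: {unit L}]%G.
have acts : [acts G, on S | scale_action e].
  apply/actsP => s _ c; apply/idP/idP => [h|]; last exact: Sact.
  rewrite -[c](actK (scale_action e) s); exact: Sact.
rewrite (card_uniform_partition (n := #|L|.-1) _ (orbit_partition acts)) ?dvdn_mull //.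
move=> _ /imsetP[c cS ->]; rewrite -card_finField_unit.
rewrite -[RHS](card_orbit_stab (scale_action e) G c).
rewrite [X in (_ * X)%N](_ : _ = 1%N) ?muln1 //; apply/eqP/cards1P; exists 1%g.
apply/setP => s; rewrite finset.in_setI finset.in_setT finset.in_set1; apply/astab1P/eqP => [/(Sfree _ _ cS) //|->].
exact: act1.
Qed.

End FreeScaling.

(* Normalizing a nonzero function by its value at a point of minimal weight makes
   s |-> (c m * s ^ ((w m - min w) / gcd)) act on the normalized functions. *)
Lemma weighted_scaling_card (L : finFieldType) (M : finType) (x0 : M)
    (I : finType) (w : I -> M -> nat) :
  exists2 r : {set M} -> M,
    (forall T : {set M}, (0 < #|T|)%N -> r T \in T) &
    forall S : {set {ffun M -> L}},
    (forall c s i a k e, c \in S -> (0 < k)%N ->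
       (forall m, m \in fsupp c -> w i m = (a + k * e m)%N) -> scale_by e c s \in S) ->
    (#|[set c in S | c (r (fsupp c)) == 1%R]%SET| =
     #|[set c in S | (c (r (fsupp c)) == 1%R) &&
          [forall i, forall m in fsupp c, forall m' in fsupp c, w i m == w i m']]%SET|
       %[mod #|L|.-1])%N.
Proof.
(* The pivot [r T] depends on the support alone, which scaling preserves. It minimizes a weight that
   is not constant on [T], if there is one, so the reduced exponent at the pivot is 0 and the action
   keeps its coefficient. *)
pose const (T : {set M}) i := [forall m in T, forall m' in T, w i m == w i m'].
pose r (T : {set M}) : M := if [pick m in T] is Some m0 then
    if [pick i | ~~ const T i] is Some i then [arg min_(m < m0 in T) w i m] else m0
  else x0.
have rT (T : {set M}) : (0 < #|T|)%N -> r T \in T.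
  move=> /card_gt0P[m mT]; rewrite /r; case: pickP => [m0 m0T|/(_ m)]; last by rewrite mT.
  by case: pickP => // i _; case: arg_minnP.
exists r => // S Sact; set R := [set c in S | _]%SET.
have -> : #|R| = (\sum_(T : {set M}) #|[set c in R | fsupp c == T]%SET|)%N.
  rewrite -sum1_card (partition_big (@fsupp L M) predT) //=.
  by apply: eq_bigr => T _; rewrite -sum1_card; apply: eq_bigl => c; rewrite !inE.
have nonconst : (#|L|.-1 %| \sum_(T : {set M} | ~~ [forall i, const T i])
    #|[set c in R | fsupp c == T]%SET|)%N.
  apply: dvdn_sum => T; rewrite negb_forall => /existsP[i0 i0T].
  have [i iT iE] : exists2 i, ~~ const T i & [pick i | ~~ const T i] = Some i.
    by case: pickP => [i iT|/(_ i0)]; [exists i | rewrite i0T].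
  have T0 : (0 < #|T|)%N.
    apply/card_gt0P; move: iT; rewrite negb_forall_in => /exists_inP[m mT _].
    by exists m.
  pose m0 := r T; have m0T : m0 \in T by apply: rT.
  have m0min m : m \in T -> (w i m0 <= w i m)%N.
    rewrite /m0 /r iE; case: pickP => [m1 m1T|/(_ m0)]; last by rewrite m0T.
    by case: arg_minnP => // m2 _ H /H.
  pose k := (\big[gcdn/0]_(m in T) (w i m - w i m0))%N.
  have kdvd m : m \in T -> (k %| w i m - w i m0)%N.
    by move=> mT; have /dvdn_biggcdP := dvdnn k; apply.
  have k0 : (0 < k)%N.
    rewrite lt0n; apply: contraNneq iT => k0.
    have cm m : m \in T -> w i m = w i m0.
      move=> mT; have := kdvd m mT; rewrite k0 dvd0n subn_eq0 => le.
      by apply/eqP; rewrite eqn_leq le m0min.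
    by apply/forall_inP => m mT; apply/forall_inP => m' m'T; rewrite !cm.
  pose e m := ((w i m - w i m0) %/ k)%N.
  have we m : m \in T -> w i m = (w i m0 + k * e m)%N.
    by move=> mT; rewrite mulnC divnK ?kdvd // subnKC // m0min.
  apply: (free_scaling_card (e := e)) => [c s|c s].
    rewrite !inE fsupp_scale => /andP[/andP[cS /eqP c1] /eqP cT].
    rewrite cT eqxx andbT; apply/andP; split.
      by apply: (Sact _ _ i (w i m0) k) => // m; rewrite cT; apply: we.
    by rewrite ffunE -/m0 -[X in _ ^+ e X]/(r T) -/m0 /e subnn div0n expr0 mulr1 -c1 cT.
  rewrite !inE => /andP[_ /eqP cT] cs; apply: (expr_unit_eq1 (P := mem T) (e := e) k0).
    apply: eq_bigr => m mT; by rewrite mulnC divnK ?kdvd.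
  move=> m mT; apply: val_inj; rewrite FinRing.val_unitX /=.
  have : m \in fsupp c by rewrite cT.
  rewrite inE => cm.
  by apply: (mulfI cm); rewrite mulr1; move/ffunP/(_ m): cs; rewrite ffunE.
rewrite (bigID (fun T => [forall i, const T i])) /= -modnDmr (eqP nonconst) addn0.
congr (_ %% _)%N; set Q := [set c in S | _]%SET.
have -> : #|Q| = (\sum_(T : {set M} | [forall i, const T i]) #|[set c in R | fsupp c == T]%SET|)%N.
  rewrite -sum1_card (partition_big (@fsupp L M) (fun T => [forall i, const T i])) //=; last first.
    by move=> c; rewrite !inE => /and3P[].
  apply: eq_bigr => T Tc; rewrite -sum1_card; apply: eq_bigl => c; rewrite !inE.
  have [->|] := eqVneq (fsupp c) T; last by rewrite !andbF.
  by rewrite Tc !andbT.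
by [].
Qed.

Lemma card_multisets (T : finType) d :
  #|[set m : {ffun T -> 'I_d.+1} | (\sum_t m t)%N == d]%SET| = 'C(#|T| + d - 1, d).
Proof.
(* The empty case arises for p > n. Truncated subtraction gives C(0, 0) = 1 for d = 0 and C(d - 1,
   d) = 0 otherwise, as the convention on binomials demands. *)
case cT: #|T| => [|v].
  have T0 (t : T) : False by have := card0_eq cT t; rewrite inE.
  pose m0 : {ffun T -> 'I_d.+1} := [ffun=> ord0].
  have sum0 (m : {ffun T -> 'I_d.+1}) : (\sum_t m t)%N = 0%N by rewrite big1 // => t; case: (T0 t).
  case: d m0 sum0 => [|d] m0 sum0; last first.
    rewrite add0n subn1 bin_small //; apply/eqP; rewrite cards_eq0; apply/eqP/setP => m.
    by rewrite !inE sum0.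
  rewrite bin0; apply/eqP/cards1P; exists m0; apply/setP => m; rewrite !inE sum0 eqxx.
  by apply/esym/eqP/ffunP => t; case: (T0 t).
have -> : (v.+1 + d - 1 = v + d)%N by rewrite addSn subn1.
have <- : 'C(v + d, v) = 'C(v + d, d).
  by rewrite -[in LHS]bin_sub ?leq_addr // addKn.
rewrite -card_ord_partitions.
pose f (t : v.+1.-tuple 'I_d.+1) : {ffun T -> 'I_d.+1} :=
  [ffun x => tnth t (cast_ord cT (enum_rank x))].
pose g (m : {ffun T -> 'I_d.+1}) : v.+1.-tuple 'I_d.+1 :=
  [tuple m (enum_val (cast_ord (esym cT) i)) | i < v.+1].
have fK : cancel f g.
  move=> t; apply: eq_from_tnth => i; rewrite tnth_mktuple ffunE enum_valK.
  by rewrite cast_ordKV.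
have gK : cancel g f.
  by move=> m; apply/ffunP => x; rewrite ffunE tnth_mktuple cast_ordK enum_rankK.
rewrite -(card_imset _ (can_inj fK)); apply: eq_card => m; rewrite inE.
have sumE t : (\sum_x f t x = \sum_(i <- t) i)%N.
  rewrite big_tuple (reindex (fun x => cast_ord cT (enum_rank x))) /=.
    by apply: eq_bigr => x _; rewrite ffunE.
  apply: onW_bij; exists (fun i => enum_val (cast_ord (esym cT) i)) => x.
    by rewrite cast_ordK enum_rankK.
  by rewrite enum_valK cast_ordKV.
apply/idP/imsetP => [md|[t td ->]]; last by rewrite sumE; rewrite inE in td.
by exists (g m); rewrite ?gK // inE -sumE gK.
Qed.

Lemma card_eq_finset (T : finType) (A : {set T}) : [set` A] #= `I_#|A|.
Proof.
have f_inj : {in [set` A] &, injective (fun x => index x (enum A))}.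
  move=> x y; rewrite !inE /= => xA yA /(congr1 (nth x (enum A))).
  by rewrite !nth_index ?mem_enum.
rewrite card_eq_sym; apply: card_eq_trans (inj_card_eq f_inj).
rewrite (_ : `I_#|A| = [set index x (enum A) | x in [set` A]]) ?card_eqxx //.
apply/seteqP; split=> [i /= iA|_ [x xA <-]].
  have /card_gt0P[x0 _] : (0 < #|A|)%N by apply: leq_ltn_trans iA.
  have iA' : (i < size (enum A))%N by rewrite -cardE.
  exists (nth x0 (enum A) i); first by rewrite /= -mem_enum mem_nth.
  by rewrite index_uniq // enum_uniq.
by rewrite /= cardE index_mem mem_enum.
Qed.

Section CoefficientFunctions.
Variables (R : nzRingType) (N D : nat).
Local Notation Mon := 'X_{1..N < D.+1}.
Implicit Types (c : {ffun Mon -> R}) (f : {mpoly R[N]}).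

(** Coefficient functions on the monomials of degree at most [D] form a finite type when [R] is
    finite, which makes forms countable by [#|_|]. *)
Definition poly_of c : {mpoly R[N]} := \sum_(m : Mon) c m *: 'X_[m].

Definition coefs f : {ffun Mon -> R} := [ffun m : Mon => f@_m].

Lemma poly_of_coef c (m : Mon) : (poly_of c)@_m = c m.
Proof.
rewrite /poly_of raddf_sum (bigD1 m) //= mcoeffZ mcoeffX eqxx mulr1 big1 ?addr0 //.
by move=> m' ne; rewrite mcoeffZ mcoeffX (inj_eq val_inj) (negPf ne) mulr0.
Qed.

Lemma poly_ofK : cancel poly_of coefs.
Proof. by move=> c; apply/ffunP => m; rewrite ffunE poly_of_coef. Qed.

Lemma poly_of_msupp c m : m \in msupp (poly_of c) -> exists2 m' : Mon, c m' != 0 & m = m'.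
Proof.
rewrite mcoeff_msupp /poly_of raddf_sum /= => h.
have [m' ] : exists m' : Mon, (c m' *: 'X_[m'] : {mpoly R[N]})@_m != 0.
  apply/existsP; apply: contraNT h; rewrite negb_exists => /forallP h.
  by rewrite big1 // => m' _; have := h m'; rewrite negbK => /eqP.
rewrite mcoeffZ mcoeffX; have [<-|_] := eqVneq (val m') m; last by rewrite mulr0 eqxx.
by rewrite mulr1; exists m'.
Qed.

Lemma coefsK f : f \is D.-homog -> poly_of (coefs f) = f.
Proof.
move=> fD; apply/mpolyP => m; have [mD|mD] := ltnP (mdeg m) D.+1.
  by have := poly_of_coef (coefs f) (BMultinom mD); rewrite ffunE.
rewrite [RHS](dhomog_nemf_coeff fD) ?gtn_eqF //.
apply: memN_msupp_eq0; apply/negP => /poly_of_msupp[m' _ mE].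
by move: mD; rewrite mE leqNgt bmdeg.
Qed.

Lemma poly_ofZ a c : poly_of [ffun m => a * c m] = a *: poly_of c.
Proof.
by rewrite /poly_of scaler_sumr; apply: eq_bigr => m _; rewrite ffunE scalerA.
Qed.

Lemma poly_of_eq0 c : (poly_of c == 0) = (c == 0).
Proof.
apply/eqP/eqP => [c0|->]; last by rewrite /poly_of big1 // => m _; rewrite ffunE scale0r.
by apply/ffunP => m; rewrite -poly_of_coef c0 mcoeff0 ffunE.
Qed.

End CoefficientFunctions.

(** * Rational points *)

Section ChangeOfField.
Variables (L : fieldType) (K : closedFieldType) (iota : {rmorphism L -> K}).

Lemma map_mpoly_inj N : injective (@map_mpoly N L K iota).
Proof.
move=> f g fg; apply/mpolyP => m; apply: (fmorph_inj iota).
by rewrite -!mcoeff_map_mpoly fg.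
Qed.

Lemma map_mpoly_homog N (mf : measure N) (f : {mpoly L[N]}) e :
  f \is e.-homog for mf -> map_mpoly iota f \is e.-homog for mf.
Proof.
move=> fe; apply/dhomogP => m; rewrite mcoeff_msupp mcoeff_map_mpoly fmorph_eq0.
by rewrite -mcoeff_msupp; apply: (dhomogP _ _ _ fe).
Qed.

(** The ratio [a] can be computed at the leading monomial of [g], where both coefficients come from
    [L]. *)
Lemma map_mpoly_proportional N (f g : {mpoly L[N]}) (a : K) : g != 0 -> a != 0 ->
  map_mpoly iota f = a *: map_mpoly iota g -> exists2 b, b != 0 & f = b *: g.
Proof.
move=> g0 a0 fg; pose b := f@_(mlead g) / mleadc g.
have ab : a = iota b.
  have := congr1 (mcoeff (mlead g)) fg; rewrite mcoeffZ !mcoeff_map_mpoly => e.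
  by rewrite /b fmorph_div /= e mulfK // fmorph_eq0 mleadc_eq0.
exists b; first by move: a0; rewrite ab fmorph_eq0.
by apply: map_mpoly_inj; rewrite fg ab -map_mpolyZ.
Qed.

Variables (n p d : nat).
Local Notation N := (p.+1 * n.+1)%N.
Local Notation D := (p.+1 * d)%N.

Lemma map_plane_mono (m : coord_sets n p -> nat) :
  map_mpoly iota (plane_mono L m) = plane_mono K m.
Proof.
rewrite /plane_mono rmorph_prod; apply: eq_bigr => J _.
by rewrite rmorphXn /= map_generic_minor.
Qed.

(** The scalar allowed in [is_chow_form] absorbs the choice of the generator [v]; conversely the
    image of [v] spans the required point over [K]. *)
Lemma rational_pointE (P : form_space L n p d) v : v != 0 -> v \in line P ->
  rational_points iota (@chow_variety K n p d) P <->
  is_chow_form d (map_mpoly iota (mpoly_of_dhomog v)).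
Proof.
move=> v0 vP; split.
  move=> [Q [C [Cd [f fQ fC]]] PQ]; have [g gQ vg] := PQ _ vP.
  have g0 : g != 0.
    apply: contraNneq v0 => g0; apply/eqP/val_inj/map_mpoly_inj.
    by rewrite [LHS]vg g0 /= raddf0.
  have [a fa] : exists a, f = a *: g.
    by move: fQ; rewrite (proj_line g0 gQ) => /vlineP[a ->]; exists a.
  have f0 : mpoly_of_dhomog f != 0.
    have [h hC ->] := fC; apply/prodf_neq0 => i _; rewrite expf_neq0 //.
    by apply: irreducible_mpoly_neq0; have [] := hC i.
  exists C; split=> //; exists a.
    by apply: contraNneq f0 => a0; rewrite fa a0 scale0r.
  by rewrite vg; move: fC; rewrite fa.
move=> [C [Cd [c c0 fC]]].
pose w : dhomog N K D := DHomog (map_mpoly_homog (dhomog_is_dhomog v)).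
have w0 : w != 0.
  apply: contraNneq v0 => /(congr1 val) /= w0; apply/eqP/val_inj/map_mpoly_inj.
  by rewrite /= w0 raddf0.
exists (point w0).
  exists C; split=> //; exists (c *: w); last exact: fC.
  by rewrite memvZ //= memv_line.
move=> f; rewrite (proj_line v0 vP) => /vlineP[a ->].
exists (iota a *: w); first by rewrite memvZ //= memv_line.
by rewrite /= map_mpolyZ.
Qed.

End ChangeOfField.

Section TorusAction.
Variables (L : finFieldType) (K : closedFieldType) (iota : {rmorphism L -> K}).
Variables (n p D : nat).
Local Notation N := (p.+1 * n.+1)%N.
Local Notation Mon := 'X_{1..N < D.+1}.
Implicit Type c : {ffun Mon -> L}.

Lemma mxsubst_diagX (t : 'rV[K]_n.+1) (m : 'X_{1..N}) :
  mxsubst (diag_mx t) 'X_[m] = (\prod_j t 0 j ^+ colw j m) *: 'X_[m].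
Proof.
apply: mxeval_inj => u; rewrite mxsubst_eval mxevalZ /mxeval meval_col_scale.
by rewrite msuppX big_seq1 mcoeffX eqxx mul1r mevalX.
Qed.

Lemma map_poly_of c :
  map_mpoly iota (poly_of c) = \sum_(m : Mon) iota (c m) *: 'X_[m].
Proof.
rewrite /poly_of raddf_sum; apply: eq_bigr => m _.
by rewrite /= map_mpolyZ map_mpolyX.
Qed.

(* The scaling s^(e m) is realized over K by the column scaling with t^k = s. *)
Lemma scale_by_subst c s j a k e (t : K) :
  (forall m : Mon, m \in fsupp c -> colw j m = (a + k * e m)%N) ->
  t ^+ k = iota (val s) ->
  mxsubst (diag_mx (\row_i (if i == j then t else 1))) (map_mpoly iota (poly_of c)) =
  t ^+ a *: map_mpoly iota (poly_of (scale_by e c s)).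
Proof.
move=> ce ts; rewrite !map_poly_of raddf_sum scaler_sumr; apply: eq_bigr => m _.
have [cm|cm] := eqVneq (c m) 0.
  by rewrite ffunE cm mul0r rmorph0 !scale0r raddf0 scaler0.
rewrite /= mxsubstZ mxsubst_diagX !scalerA; congr (_ *: _).
rewrite (bigD1 j) //= big1 => [|i ij]; last by rewrite mxE (negPf ij) expr1n.
rewrite mxE eqxx mulr1 (ce m) ?inE // exprD exprM ts ffunE rmorphM rmorphXn /=.
by rewrite mulrCA.
Qed.

End TorusAction.

Section Normalization.
Variables (L : finFieldType) (N D : nat).
Local Notation Mon := 'X_{1..N < D.+1}.
Implicit Types (c : {ffun Mon -> L}) (f : {mpoly L[N]}).
Variable r : {set Mon} -> Mon.
Hypothesis rP : forall T : {set Mon}, (0 < #|T|)%N -> r T \in T.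

(** Selects one generator of each line of forms: scalars do not change the support, hence do not
    move the pivot. *)
Definition normalized c := c (r (fsupp c)) == 1.

Definition normalize c : {ffun Mon -> L} := [ffun m => (c (r (fsupp c)))^-1 * c m].

Lemma pivot_neq0 c : c != 0 -> c (r (fsupp c)) != 0.
Proof.
move=> c0; have /rP : (0 < #|fsupp c|)%N; last by rewrite inE.
apply/card_gt0P/existsP; apply: contraNT c0; rewrite negb_exists => /forallP h.
by apply/eqP/ffunP => m; have := h m; rewrite inE negbK ffunE => /eqP.
Qed.

Lemma fsupp_scalar a c : a != 0 -> fsupp [ffun m => a * c m] = fsupp c.
Proof.
by move=> a0; apply/setP => m; rewrite !inE ffunE mulf_eq0 (negPf a0).
Qed.

Lemma normalizedP c : c != 0 -> normalized (normalize c).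
Proof.
move=> /pivot_neq0 c0; rewrite /normalized fsupp_scalar ?invr_eq0 //.
by rewrite ffunE mulVf.
Qed.

Lemma normalized_uniq c c' a : a != 0 -> normalized c -> normalized c' ->
  poly_of c = a *: poly_of c' -> c = c'.
Proof.
move=> a0; rewrite -poly_ofZ => nc nc' /(can_inj (@poly_ofK _ _ _)) cc'.
move: nc; rewrite /normalized cc' fsupp_scalar // ffunE (eqP nc') mulr1 => /eqP->.
by apply/ffunP => m; rewrite ffunE mul1r.
Qed.

Lemma poly_of_normalize c :
  poly_of (normalize c) = (c (r (fsupp c)))^-1 *: poly_of c.
Proof. exact: poly_ofZ. Qed.

End Normalization.

Theorem corollary4p6 (F L : finFieldType) (K : closedFieldType)
    (j : {rmorphism F -> L}) (iota : {rmorphism L -> K})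
    (K_alg : integralRange (iota \o j))
    (m : nat) (m_gt0 : (0 < m)%N) (cardL : #|L| = (#|F| ^ m)%N)
    (n p d : nat) :
  exists2 N : nat,
    rational_points iota (@chow_variety K n p d) #= `I_N &
    (N = 'C('C(n.+1, p.+1) + d - 1, d) %[mod #|F| - 1])%N.
Proof.
pose N := (p.+1 * n.+1)%N; pose D := (p.+1 * d)%N.
pose Mon : finType := 'X_{1..N < D.+1}.
pose w (i : 'I_n.+1) (x : Mon) := colw i (val x).
have [r rP rS] := weighted_scaling_card L (bm0 : Mon) w.
(* [S] contains the Chow forms over [L] with all their scalar multiples. Below, [R] keeps the
   normalized ones, one for each rational point, and [Fx] those among them that are homogeneous in
   every column. *)
pose S := [set c : {ffun Mon -> L} | `[< [/\ c != 0, poly_of c \is D.-homog &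
  is_chow_form d (map_mpoly iota (poly_of c) : {mpoly K[p.+1 * n.+1]})] >]]%SET.
have inS c : reflect [/\ c != 0, poly_of c \is D.-homog &
    is_chow_form d (map_mpoly iota (poly_of c) : {mpoly K[p.+1 * n.+1]})] (c \in S).
  by rewrite inE; apply: asboolP.
have {rS} := rS S _; set R := [set c in S | _]%SET; set Fx := [set c in S | _ && _]%SET.
have Sact c s i a k e : c \in S -> (0 < k)%N ->
    (forall x, x \in fsupp c -> w i x = (a + k * e x)%N) -> scale_by e c s \in S.
  move=> /inS[c0 cD cC] k0 ce; apply/inS.
  have supp_s : fsupp (scale_by e c s) = fsupp c by apply: fsupp_scale.
  have s0 : iota (val s) != 0 by rewrite fmorph_eq0 -unitfE; apply: valP.
  (* The root is taken in [K] and may lie outside the image of [L]; being a Chow form is a condition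
     over [K]. *)
  have [t ts] : exists t, t ^+ k = iota (val s).
    have /closed_rootP[t] : size ('X^k - (iota (val s))%:P) != 1%N.
      by rewrite size_XnsubC // eqSS -lt0n.
    by rewrite rootE !hornerE subr_eq0 => /eqP; exists t.
  have t0 : t != 0 by apply: contraNneq s0 => t0; rewrite -ts t0 expr0n gtn_eqF.
  have sub := scale_by_subst ce ts.
  split.
  - have [x xc] : exists x, x \in fsupp c.
      by exists (r (fsupp c)); rewrite inE pivot_neq0.
    rewrite -supp_s inE in xc.
    by apply: contraNneq xc => ->; rewrite ffunE.
  - apply/dhomogP => x /poly_of_msupp[y yc ->].
    apply: (dhomogP _ _ _ cD); rewrite mcoeff_msupp poly_of_coef.
    have : y \in fsupp (scale_by e c s) by rewrite inE.
    by rewrite supp_s inE.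
  have VU : diag_mx (\row_i0 (if i0 == i then t else 1)) \in unitmx.
    rewrite unitmxE det_diag unitfE; apply/prodf_neq0 => i' _; rewrite mxE.
    by case: ifP; rewrite ?oner_neq0.
  have := is_chow_form_subst VU cC; rewrite sub => tC.
  have ta0 : t ^- a != 0 by rewrite invr_eq0 expf_neq0.
  by have := is_chow_formZ ta0 tC; rewrite scalerA mulVf ?expf_neq0 // scale1r.
move=> /(_ Sact) RFx.
(* The normalized generator of each point; [psi] below is a bijection from the rational points onto
   [R]. *)
have pointR : forall P : form_space L n p d, exists c : {ffun Mon -> L},
    normalized r c /\ exists v, [/\ v != 0, v \in line P & mpoly_of_dhomog v = poly_of c].
  move=> P; have [v v0 vP] := proj_pick P.
  pose c := coefs D (mpoly_of_dhomog v).
  have cv : poly_of c = mpoly_of_dhomog v by apply: coefsK; apply: dhomog_is_dhomog.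
  have c0 : c != 0.
    by rewrite -poly_of_eq0 cv; apply: contraNneq v0 => v0; apply/eqP/val_inj.
  exists (normalize r c); split; first exact: normalizedP.
  exists ((c (r (fsupp c)))^-1 *: v); split; last 1 first.
  - by rewrite poly_of_normalize cv.
  - by rewrite scaler_eq0 negb_or invr_eq0 pivot_neq0.
  - exact: memvZ.
have [psi psiP] := boolp.choice pointR.
exists #|R|.
  have psi_inj : {in rational_points iota (@chow_variety K n p d) &, injective psi}.
    move=> P Q _ _ PQ; have [_ [v [v0 vP vE]]] := psiP P.
    have [_ [v' [v'0 v'Q v'E]]] := psiP Q.
    apply: proj_eq; rewrite (proj_line v0 vP) (proj_line v'0 v'Q).
    by congr (<[_]>%VS); apply/val_inj; rewrite [LHS]vE [RHS]v'E PQ.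
  have psiR : psi @` rational_points iota (@chow_variety K n p d) = [set` R].
    apply/seteqP; split=> [_ [P PX <-]|c /=].
      have [nP [v [v0 vP vE]]] := psiP P.
      rewrite /= inE [X in _ && X]nP andbT; apply/inS; rewrite -vE.
      split; [|exact: dhomog_is_dhomog|exact/(rational_pointE _ v0 vP)].
      by rewrite -poly_of_eq0 -vE; apply: contraNneq v0 => v0; apply/eqP/val_inj.
    rewrite inE => /andP[/inS[c0 cD cC] nc].
    pose v : dhomog N L D := DHomog cD.
    have v0 : v != 0 by apply: contraNneq c0 => /(congr1 val) /= /eqP; rewrite poly_of_eq0.
    have vP : v \in line (point v0) by rewrite memv_line.
    exists (point v0); first exact/(rational_pointE _ v0 vP).
    have [nP [v' [v'0]]] := psiP (point v0).
    move=> /vlineP[a v'E] v'P; apply: (@normalized_uniq _ _ _ r _ _ a) => //.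
      by apply: contraNneq v'0 => a0; rewrite v'E a0 scale0r.
    by rewrite -v'P v'E.
  apply: card_eq_trans (card_eq_finset R); rewrite card_eq_sym -psiR.
  exact: inj_card_eq.
(* Here q - 1 divides q^m - 1, so the congruence between [R] and [Fx] modulo [#|L|.-1] descends. *)
have qdvd : (#|F| - 1 %| #|L|.-1)%N by rewrite cardL subn1 dvdn_pred_predX.
have <- : #|Fx| = 'C('C(n.+1, p.+1) + d - 1, d); last first.
  by rewrite -(modn_dvdm _ qdvd) RFx modn_dvdm.
have cardJ : #|{: coord_sets n p}| = 'C(n.+1, p.+1).
  rewrite card_sig -[in RHS](card_ord n.+1) -card_draws.
  by apply: eq_card => J; rewrite !inE.
rewrite -cardJ -card_multisets.
set MS := [set x : {ffun _ -> 'I_d.+1} | _]%SET.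
pose mono (x : {ffun coord_sets n p -> 'I_d.+1}) := plane_mono L (fun J => x J).
have monoD x : x \in MS -> mono x \is D.-homog.
  by rewrite inE => /eqP xd; rewrite /D -xd; apply: plane_mono_homog.
have mono0 x : mono x != 0.
  apply: contraNneq (plane_mono_neq0 K (fun J => x J)) => e.
  by rewrite -(map_plane_mono iota) -/(mono x) e raddf0.
(* Normalized products of minors: [g] is to be a bijection from the multisets of size [d] onto
   [Fx]. *)
pose g x := normalize r (coefs D (mono x)).
have gE x : x \in MS -> exists2 a, a != 0 & poly_of (g x) = a *: mono x.
  move=> xd; have xK := coefsK (monoD x xd).
  exists (coefs D (mono x) (r (fsupp (coefs D (mono x)))))^-1.
    by rewrite invr_eq0 pivot_neq0 // -poly_of_eq0 xK.
  by rewrite poly_of_normalize xK.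
have gN x : x \in MS -> normalized r (g x).
  by move=> xd; apply: normalizedP => //; rewrite -poly_of_eq0 (coefsK (monoD x xd)).
have gI : {in MS &, injective g}.
  move=> x y xd yd gxy; have [a a0 xa] := gE x xd; have [b b0 yb] := gE y yd.
  have : plane_mono K (fun J => x J) = iota (a^-1 * b) *: plane_mono K (fun J => y J).
    rewrite -!(map_plane_mono iota) -map_mpolyZ; congr (map_mpoly _ _).
    rewrite -[LHS]/(mono x) -scalerA -[X in _ *: (_ *: X)]/(mono y) -yb -gxy xa.
    by rewrite scalerA mulVf // scale1r.
  move/plane_mono_inj; rewrite fmorph_eq0 mulf_neq0 ?invr_eq0 // => /(_ isT) xy.
  by apply/ffunP => J; apply/val_inj/xy.
rewrite -(card_in_imset gI); apply: eq_card => c; apply/idP/imsetP.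
  rewrite inE => /and3P[/inS[c0 cD cC] nc /forallP cw].
  have ccol : col_homog (poly_of c).
    move=> i; exists (w i (r (fsupp c))); apply/dhomogP => x /poly_of_msupp[y yc ->].
    have /forall_inP/(_ y) := cw i; rewrite inE => /(_ yc)/forall_inP/(_ (r (fsupp c))).
    by rewrite inE pivot_neq0 // => /(_ isT)/eqP.
  (* The decomposition into minors takes place over [K]. The minors have coefficients in the prime
     ring, so only the scalar has to be brought back to [L]. *)
  have [x [a [xd a0 xE]]] := toric_chow_form (map_mpoly_homog iota cD)
    (fun i => let: ex_intro e h := ccol i in ex_intro _ e (map_mpoly_homog iota h)) cC.
  pose y : {ffun coord_sets n p -> 'I_d.+1} := [ffun J => inord (x J)].
  have yx J : y J = x J :> nat.
    by rewrite ffunE inordK // ltnS -xd (bigD1 J) //= leq_addr.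
  have yMS : y \in MS by rewrite inE -[X in _ == X]xd; apply/eqP/eq_bigr => J _.
  have xy : plane_mono K x = map_mpoly iota (mono y).
    by rewrite map_plane_mono; apply: eq_bigr => J _; rewrite yx.
  rewrite xy in xE; have [b b0 cb] := map_mpoly_proportional (mono0 y) a0 xE.
  exists y => //; have [e e0 ge] := gE y yMS.
  apply: (@normalized_uniq _ _ _ r _ _ (b / e)) (gN y yMS) _ => //.
    by rewrite mulf_neq0 ?invr_eq0.
  by rewrite ge scalerA divfK.
move=> [x xd ->]; have [a a0 ga] := gE x xd.
rewrite inE; apply/and3P; split; [|exact: gN|].
  apply/inS; split.
  - by rewrite -poly_of_eq0 ga scaler_eq0 negb_or a0 mono0.
  - by rewrite ga dhomogZ // monoD.
  rewrite ga map_mpolyZ map_plane_mono; apply: is_chow_formZ; first by rewrite fmorph_eq0.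
  by apply: plane_mono_chow_form; move: xd; rewrite inE => /eqP.
apply/forallP => i; have [e eP] := plane_mono_col_homog L (fun J => x J) i.
have we y : y \in fsupp (g x) -> w i y = e.
  rewrite inE -poly_of_coef ga mcoeffZ mulf_eq0 negb_or => /andP[_ yx].
  by apply: (dhomogP _ _ _ eP); rewrite mcoeff_msupp.
by apply/forall_inP => y yg; apply/forall_inP => y' y'g; rewrite !we.
Qed.
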